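(* Let $S$ be a densely defined, closed, symmetric operator in a Hilbert space $\mathcal H$ and let $\Pi=\{\mathcal G,\Gamma_0,\Gamma_1\}$ be a quasi boundary triple for $T\subset S^*$ with Weyl function $M$. Assume that $$\Gamma_1|A_0-\mu|^{-\alpha}:\mathcal H\supset\operatorname{dom}(\Gamma_1|A_0-\mu|^{-\alpha})\to\mathcal G$$ is bounded for some $\mu\in\rho(A_0)$ and some $\alpha\in(0,\frac12]$. Then the following hold. (a) $M(\lambda)$ is bounded for all $\lambda\in\rho(A_0)$. (b) For all $z_0\in\overline{\mathbb C^+}\cap\rho(A_0)$ and all $\theta\in(0,\frac\pi2)$ there exists $C=C(\Pi,\alpha,\mu,z_0,\theta)>0$ such that $$\|\overline{M(\lambda)}\|\le\frac{C}{\bigl(\operatorname{dist}(\lambda,\sigma(A_0))\bigr)^{1-2\alpha}}\qquad\text{for all }\lambda\in\mathbb S_{z_0,\theta}\cup\mathbb S_{z_0,\theta}^*.$$ (c) If $A_0$ is bounded from below, then for all $w_0<\min\sigma(A_0)$ and all $\nu\in(0,\pi)$ there exists $D=D(\Pi,\alpha,\mu,w_0,\nu)>0$ such that $$\|\overline{M(\lambda)}\|\le\frac{D}{\bigl(\operatorname{dist}(\lambda,\sigma(A_0))\bigr)^{1-2\alpha}}\qquad\text{for all }\lambda\in\mathbb U_{w_0,\nu}.$$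
   Context: Quasi boundary triple: let $S$ be a densely defined, closed, symmetric operator in a Hilbert space $\mathcal H$ and $T\subset S^*$ a linear operator with $\overline T=S^*$. $\{\mathcal G,\Gamma_0,\Gamma_1\}$ is a quasi boundary triple for $T\subset S^*$ if $\mathcal G$ is a Hilbert space and $\Gamma_0,\Gamma_1:\operatorname{dom}T\to\mathcal G$ are linear maps such that: (1) $(Tf,g)-(f,Tg)=(\Gamma_1f,\Gamma_0g)-(\Gamma_0f,\Gamma_1g)$ for all $f,g\in\operatorname{dom}T$; (2) $(\Gamma_0,\Gamma_1)^\top:\operatorname{dom}T\to\mathcal G\times\mathcal G$ has dense range; (3) $A_0:=T\upharpoonright\ker\Gamma_0$ is self-adjoint in $\mathcal H$. For $\lambda\in\rho(A_0)$, $\Gamma_0\upharpoonright\ker(T-\lambda)$ is injective; the Weyl function is $M(\lambda)=\Gamma_1(\Gamma_0\upharpoonright\ker(T-\lambda))^{-1}$, a closable operator defined on the dense subspace $\operatorname{ran}\Gamma_0$ of $\mathcal G$; $\overline{M(\lambda)}$ is its closure. $|A_0-\mu|^{-\alpha}$ is defined by the functional calculus of $A_0$, and $\operatorname{dom}(\Gamma_1|A_0-\mu|^{-\alpha})=\{f\in\mathcal H:|A_0-\mu|^{-\alpha}f\in\operatorname{dom}T\}$. $\mathbb C^+=\{\lambda:\operatorname{Im}\lambda>0\}$. Sectors: $\mathbb S_{z_0,\theta}=\{z\in\mathbb C:z\ne z_0,\ \arg(z-z_0)\in[\frac\pi2-\theta,\frac\pi2+\theta]\}\cup\{z_0\}$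 for $z_0\in\overline{\mathbb C^+}$, $\theta\in(0,\frac\pi2)$; $\mathbb S_{z_0,\theta}^*=\{z:\overline z\in\mathbb S_{z_0,\theta}\}$; $\mathbb U_{w_0,\nu}=\{z\in\mathbb C:z\ne w_0,\ \arg(z-w_0)\in[\nu,2\pi-\nu]\}\cup\{w_0\}$ for $w_0\in\mathbb R$, $\nu\in(0,\pi)$, with $\arg\in[0,2\pi)$. *)

(* Defs.v *)
From HB Require Import structures.
From mathcomp Require Import all_boot all_order all_algebra.
From mathcomp Require Import sesquilinear complex.
From mathcomp Require Import all_classical all_reals all_analysis.

Set Implicit Arguments.
Unset Strict Implicit.
Unset Printing Implicit Defensive.

Import Order.TTheory GRing.Theory Num.Theory numFieldNormedType.Exports.

Local Open Scope classical_set_scope.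
Local Open Scope complex_scope.
Local Open Scope ring_scope.

(** Complex Hilbert spaces.  The inner product is linear in its first argument
    and conjugate-linear in its second. *)
HB.mixin Record hasInnerProduct (R : realType) H
    of CompleteNormedModule R[i] H := {
  ip : {dot H for @Num.conj R[i]};
  normr_ip : forall x : H, `|x| ^+ 2 = ip x x
}.

#[short(type="hilbertType")]
HB.structure Definition Hilbert (R : realType) :=
  {H of hasInnerProduct R H & CompleteNormedModule R[i] H}.

(** The library norm [`|x|] is a nonnegative real element of [R[i]]. *)
Definition nrm (R : realType) (V : normedModType R[i]) (x : V) : R :=
  complex.Re `|x|.

Definition cabs (R : realType) (z : R[i]) : R := complex.Re `|z|.

(** Linear operators between spaces [H] and [K], defined on a linear subspace
    [dom] of [H]; the values of [app] outside [dom] are irrelevant. *)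
Record linop (R : realType) (H K : lmodType R[i]) := Linop {
  dom : set H;
  app :> H -> K;
  dom0 : dom 0;
  domP : forall (a : R[i]) x y, dom x -> dom y -> dom (a *: x + y);
  appP : forall (a : R[i]) x y, dom x -> dom y ->
    app (a *: x + y) = a *: app x + app y
}.

Definition graph (R : realType) (H K : lmodType R[i]) (A : linop H K)
  : set (H * K) := [set p | dom A p.1 /\ p.2 = A p.1].

(** Derived operators (adjoints, closures, inverses, ...) are handled through
    their graphs. *)
Section graphs.
Context {R : realType}.

Definition rel_dom (X Y : Type) (A : set (X * Y)) : set X :=
  [set x | exists y, A (x, y)].

Definition rel_inv (X Y : Type) (A : set (X * Y)) : set (Y * X) :=
  [set p | A (p.2, p.1)].

Definition rel_restrict (X Y : Type) (A : set (X * Y)) (D : set X)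
  : set (X * Y) := [set p | A p /\ D p.1].

(** [rel_comp B A] is the product [B A] on its natural domain
    [{f in dom A | A f in dom B}]. *)
Definition rel_comp (X Y Z : Type) (B : set (Y * Z)) (A : set (X * Y))
  : set (X * Z) := [set p | exists y, A (p.1, y) /\ B (y, p.2)].

(** [ker (A - z)] *)
Definition rel_eigenspace (H : lmodType R[i]) (A : set (H * H)) (z : R[i])
  : set H := [set f | A (f, z *: f)].

Definition rel_ker (H K : lmodType R[i]) (A : set (H * K)) : set H :=
  [set f | A (f, 0)].

Definition adjoint (H K : hilbertType R) (A : set (H * K)) : set (K * H) :=
  [set q | forall p, A p -> ip p.2 q.1 = ip p.1 q.2].

Definition self_adjoint (H : hilbertType R) (A : set (H * H)) : Prop :=
  dense (rel_dom A) /\ A = adjoint A.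

Definition bounded_rel (H K : hilbertType R) (A : set (H * K)) : Prop :=
  exists c : R, forall p, A p -> nrm p.2 <= c * nrm p.1.

Definition op_norm (H K : hilbertType R) (A : set (H * K)) : \bar R :=
  ereal_sup [set (nrm p.2)%:E | p in [set p | A p /\ nrm p.1 <= 1]].

(** [z] is in the resolvent set when [A - z] is a bijection from its domain
    onto [H] with bounded inverse. *)
Definition resolvent_set (H : hilbertType R) (A : set (H * H)) : set R[i] :=
  [set z | (forall h, exists! f, A (f, h + z *: f)) /\
           (exists c : R, forall p, A p ->
              nrm p.1 <= c * nrm (p.2 - z *: p.1))].

Definition spectrum (H : hilbertType R) (A : set (H * H)) : set R[i] :=
  ~` resolvent_set A.

Definition dist (z : R[i]) (D : set R[i]) : R :=
  inf [set cabs (z - w) | w in D].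

Definition bounded_below (H : hilbertType R) (A : set (H * H)) : Prop :=
  exists c : R, forall p, A p -> c * nrm p.1 ^+ 2 <= complex.Re (ip p.2 p.1).

(** The infimum of the spectrum of a self-adjoint operator bounded from below;
    it is a minimum since the spectrum is then closed, and nonempty as soon as
    the space is nonzero. *)
Definition min_spectrum (H : hilbertType R) (A : set (H * H)) : R :=
  inf [set t : R | spectrum A t%:C].

End graphs.

Section functional_calculus.
Context {R : realType} {H : hilbertType R}.
Implicit Types (E : set (measurableTypeR R) -> H -> H) (phi : R -> R).

Record projection_valued_measure E : Prop := ProjectionValuedMeasure {
  pvm_linear : forall B, measurable B -> linear (E B);
  pvm_idem : forall B, measurable B -> forall f, E B (E B f) = E B f;
  pvm_sym : forall B, measurable B -> forall f g, ip (E B f) g = ip f (E B g);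
  pvm_setT : forall f, E setT f = f;
  pvm_sigma_additive : forall F : nat -> set (measurableTypeR R),
    (forall n, measurable (F n)) -> trivIset setT F -> forall f,
    (fun n => \sum_(k < n) E (F k) f) @ \oo --> E (\bigcup_k F k) f
}.

Definition spectral_mu E (f : H) : set (measurableTypeR R) -> \bar R :=
  fun B => (complex.Re (ip (E B f) f))%:E.

Definition spectral_dom E phi : set H :=
  [set f | (spectral_mu E f).-integrable setT (fun t => (phi t ^+ 2)%:E)].

(** The integral of [phi] against the complex measure [B |-> (E B f, g)],
    which by polarization is a combination of four positive measures. *)
Definition spectral_form E phi (f g : H) : R[i] :=
  4%:R^-1 * \sum_(k < 4) 'i%C ^+ k *
    (fine (\int[spectral_mu E (f + 'i%C ^+ k *: g)%R]_t (phi t)%:E)%E)%:C.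

(** The graph of the integral of [phi] (a real Borel function) with respect
    to [E].  As [spectral_dom E phi] is dense, testing against its elements
    determines the value. *)
Definition spectral_integral E phi : set (H * H) :=
  [set p | spectral_dom E phi p.1 /\
     forall g, spectral_dom E phi g -> ip p.2 g = spectral_form E phi p.1 g].

Definition spectral_measure_of (A : set (H * H)) E : Prop :=
  projection_valued_measure E /\ A = spectral_integral E id.

(** [B] is the operator [phi(A)].  By the spectral theorem a self-adjoint
    operator [A] has exactly one spectral measure, hence there is exactly one
    such [B]. *)
Definition functional_calculus (A : set (H * H)) phi (B : set (H * H)) : Prop :=
  exists E, spectral_measure_of A E /\ B = spectral_integral E phi.

End functional_calculus.

Section boundary_triples.
Context {R : realType} {H G : hilbertType R}.
Implicit Types (S T : linop H H).

Definition closed_symmetric S : Prop :=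
  [/\ dense (dom S), closed (graph S) & graph S `<=` adjoint (graph S)].

Definition A0_of T (Gamma0 : linop H G) : set (H * H) :=
  rel_restrict (graph T) (rel_ker (graph Gamma0)).

Record quasi_boundary_triple S T (Gamma0 Gamma1 : linop H G) : Prop := QuasiBoundaryTriple {
  qbt_sub : graph T `<=` adjoint (graph S);
  qbt_closure : closure (graph T) = adjoint (graph S);
  qbt_dom0 : dom Gamma0 = dom T;
  qbt_dom1 : dom Gamma1 = dom T;
  qbt_green : forall f g, dom T f -> dom T g ->
    ip (T f) g - ip f (T g) =
    ip (Gamma1 f) (Gamma0 g) - ip (Gamma0 f) (Gamma1 g);
  qbt_dense : dense [set (Gamma0 f, Gamma1 f) | f in dom T];
  qbt_self_adjoint : self_adjoint (A0_of T Gamma0)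
}.

Definition weyl T (Gamma0 Gamma1 : linop H G) (z : R[i]) : set (G * G) :=
  rel_comp (graph Gamma1)
    (rel_inv (rel_restrict (graph Gamma0) (rel_eigenspace (graph T) z))).

End boundary_triples.

Section sectors.
Context {R : realType}.

(** [t] is the argument of [z <> 0], normalized to [[0, 2 pi[]. *)
Definition is_arg (z : R[i]) (t : R) : Prop :=
  0 <= t < 2 * pi /\ z = (cabs z)%:C * (cos t +i* sin t).

Definition sectorS (z0 : R[i]) (theta : R) : set R[i] :=
  [set z | z <> z0 /\ exists t,
     is_arg (z - z0) t /\ pi / 2 - theta <= t <= pi / 2 + theta]
  `|` [set z0].

Definition sectorS_conj (z0 : R[i]) (theta : R) : set R[i] :=
  [set z | sectorS z0 theta z^*].

Definition sectorU (w0 : R) (nu : R) : set R[i] :=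
  [set z | z <> w0%:C /\ exists t,
     is_arg (z - w0%:C) t /\ nu <= t <= 2 * pi - nu]
  `|` [set w0%:C].

End sectors.

(* Main.v *)
(** For [f] with [T f = lambda f], Green's identity gives
    [(f, (A0 - conj lambda) k) = (Gamma0 f, Gamma1 k)] for all [k] in the domain
    of [A0].  Put [psi t = |t - mu| ^ alpha] and let [h] be [psi(A0) f], truncated
    to a set on which [psi] is bounded.  With
    [k = (A0 - conj lambda)^-1 psi(A0) h] this reads
    [|h|^2 = (Gamma0 f, Gamma1 k) <= c |Gamma0 f| |psi(A0) k|
           <= c s |Gamma0 f| |h|], where [c] bounds [Gamma1 |A0 - mu|^-alpha]
    and [s] bounds [psi^2 / |t - lambda|] on the spectrum.  Hence
    [|h| <= c s |Gamma0 f|] uniformly in the truncation, [f] lies in the domain of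
    [psi(A0)], and [|Gamma1 f| <= c |psi(A0) f| <= c^2 s |Gamma0 f|].  If
    [|t - mu| <= k |t - lambda|] on the spectrum, then [s] may be taken as
    [k ^ (2 alpha) / dist ^ (1 - 2 alpha)], and the sectors are regions where
    [k] can be chosen independently of [lambda]. *)
Require Import Defs.
From HB Require Import structures.
From mathcomp Require Import all_boot all_order all_algebra.
From mathcomp Require Import sesquilinear complex.
From mathcomp Require Import all_classical all_reals all_analysis.
From mathcomp Require Import measurable_realfun ring lra.

Set Implicit Arguments.
Unset Strict Implicit.
Unset Printing Implicit Defensive.

Import Order.TTheory GRing.Theory Num.Theory numFieldNormedType.Exports.

Local Open Scope classical_set_scope.
Local Open Scope complex_scope.
Local Open Scope ring_scope.

(** * Norms and inner products *)

(** The definition of [phi(A0)] is weak: it covers real [phi] and tests against vectors of the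
    domain. The argument needs products of unbounded functions and the complex function
    [1 / (t - conj lam)], so the calculus is rebuilt on the local relation [applies], which compares
    [phi] with constants on spectral sets. Sums and products then reduce to estimates on sets where
    all functions involved are nearly constant. These are glued by countable additivity of
    [B |-> |E B v|^2], which is why norms appear squared. Integrals return in three places: the
    identity of [|phi(A0) f|^2] with an integral, which decides membership in the domain;
    polarization, which matches [applies] with the weak definition; and monotone convergence, which
    removes the truncation. That truncation is forced, since nothing is known beforehand about
    [psi(A0)] on a vector of [dom T]. The bounds hold on the spectrum, whereas the functions live on
    the real line; the link is one Borel null set containing every real resolvent point. The bound
    [c] is used for [k] and again for [f], each time at the cost of a factor [psi]: hence [psi^2]
    and the exponent [2 alpha]. *)

Section complex_modulus.
Context {R : realType}.
Implicit Types z w : R[i].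

Lemma normE z : `|z| = (cabs z)%:C.
Proof. by rewrite /cabs normc_def. Qed.

Lemma cabsE z : cabs z = Num.sqrt (complex.Re z ^+ 2 + complex.Im z ^+ 2).
Proof. by rewrite /cabs normc_def. Qed.

Lemma cabs_sqr z : cabs z ^+ 2 = complex.Re z ^+ 2 + complex.Im z ^+ 2.
Proof. by rewrite cabsE sqr_sqrtr // addr_ge0 // sqr_ge0. Qed.

Lemma cabs_ge0 z : 0 <= cabs z.
Proof. by rewrite cabsE sqrtr_ge0. Qed.

Lemma cabsD z w : cabs (z + w) <= cabs z + cabs w.
Proof. by rewrite -lecR rmorphD /= -!normE ler_normD. Qed.

Lemma cabsM z w : cabs (z * w) = cabs z * cabs w.
Proof. by apply: complexI; rewrite rmorphM /= -!normE normrM. Qed.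

Lemma cabsV z : cabs z^-1 = (cabs z)^-1.
Proof. by apply: complexI; rewrite fmorphV /= -!normE normfV. Qed.

Lemma cabsN z : cabs (- z) = cabs z.
Proof. by rewrite /cabs normrN. Qed.

Lemma cabsBC z w : cabs (z - w) = cabs (w - z).
Proof. by rewrite -cabsN opprB. Qed.

Lemma cabs_conj z : cabs z^* = cabs z.
Proof. by rewrite /cabs normcJ. Qed.

Lemma cabsR (x : R) : cabs x%:C = `|x|.
Proof. by rewrite cabsE /= expr0n addr0 sqrtr_sqr. Qed.

Lemma cabs0 : cabs (0 : R[i]) = 0.
Proof. by rewrite /cabs normr0. Qed.

Lemma cabs_eq0 z : cabs z = 0 -> z = 0.
Proof. by move=> z0; apply/eqP; rewrite -normr_eq0 normE z0. Qed.

Lemma cabs_gt0 z : z != 0 -> 0 < cabs z.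
Proof.
move=> z0; rewrite lt_def cabs_ge0 andbT; apply: contra z0 => /eqP.
by move=> /cabs_eq0 ->.
Qed.

Lemma ler_cabs_sub z w : cabs z <= cabs (z - w) + cabs w.
Proof. by rewrite -{1}(subrK w z) cabsD. Qed.

Lemma normr_Re_le z : `|complex.Re z| <= cabs z.
Proof.
rewrite -(@ler_pXn2r _ 2) ?nnegrE ?cabs_ge0 //.
by rewrite cabs_sqr real_normK ?num_real // lerDl sqr_ge0. Qed.

Lemma normr_Im_le z : `|complex.Im z| <= cabs z.
Proof.
rewrite -(@ler_pXn2r _ 2) ?nnegrE ?cabs_ge0 //.
by rewrite cabs_sqr real_normK ?num_real // lerDr sqr_ge0. Qed.

Lemma ReD z w : complex.Re (z + w) = complex.Re z + complex.Re w.
Proof. by case: z w => [a b] [c d]. Qed.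

Lemma ReN z : complex.Re (- z) = - complex.Re z.
Proof. by case: z. Qed.

Lemma ImD z w : complex.Im (z + w) = complex.Im z + complex.Im w.
Proof. by case: z w => [a b] [c d]. Qed.

Lemma ImN z : complex.Im (- z) = - complex.Im z.
Proof. by case: z. Qed.

Lemma ReM z w : complex.Re (z * w) =
  complex.Re z * complex.Re w - complex.Im z * complex.Im w.
Proof. by case: z w => [a b] [c d]. Qed.

Lemma ImM z w : complex.Im (z * w) =
  complex.Re z * complex.Im w + complex.Im z * complex.Re w.
Proof. by case: z w => [a b] [c d] /=; rewrite addrC. Qed.

Lemma ReC z : complex.Re z^* = complex.Re z.
Proof. by case: z. Qed.

Lemma ImC z : complex.Im z^* = - complex.Im z.
Proof. by case: z. Qed.

Lemma conjR (x : R) : (x%:C)^* = x%:C.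
Proof. exact: conjc_real. Qed.

Lemma mul_conj z : z * z^* = (cabs z ^+ 2)%:C.
Proof. by rewrite -sqr_normc normE rmorphXn. Qed.

End complex_modulus.

Section norm.
Context {R : realType} {V : normedModType R[i]}.
Implicit Types x y : V.

Lemma nrmE x : `|x| = (nrm x)%:C.
Proof. by rewrite /nrm RRe_real // ger0_real. Qed.

Lemma nrm_ge0 x : 0 <= nrm x.
Proof. by rewrite -ler0c -nrmE. Qed.

Lemma nrm0 : nrm (0 : V) = 0.
Proof. by rewrite /nrm normr0. Qed.

Lemma nrm_eq0 x : nrm x = 0 -> x = 0.
Proof. by move=> x0; apply/eqP; rewrite -normr_eq0 nrmE x0. Qed.

Lemma nrmD x y : nrm (x + y) <= nrm x + nrm y.
Proof. by rewrite -lecR rmorphD /= -!nrmE ler_normD. Qed.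

Lemma nrmN x : nrm (- x) = nrm x.
Proof. by rewrite /nrm normrN. Qed.

Lemma nrmBC x y : nrm (x - y) = nrm (y - x).
Proof. by rewrite -nrmN opprB. Qed.

Lemma nrmZ (a : R[i]) x : nrm (a *: x) = cabs a * nrm x.
Proof. by apply: complexI; rewrite rmorphM /= -normE -!nrmE normrZ. Qed.

Lemma nrm_tri x y z : nrm (x - z) <= nrm (x - y) + nrm (y - z).
Proof. by rewrite -[x - z](subrKA y) nrmD. Qed.

Lemma nrm_le_sub x y : nrm x <= nrm (x - y) + nrm y.
Proof. by rewrite -{1}(subrK y x) nrmD. Qed.

Lemma nrm_small x : (forall e, 0 < e -> nrm x <= e) -> x = 0.
Proof.
move=> h; apply: nrm_eq0; apply/eqP; rewrite eq_le nrm_ge0 andbT.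
by apply/ler_addgt0Pr => e e0; rewrite add0r; exact: h.
Qed.

Lemma cvg_nrmP (u : V^nat) x : u @ \oo --> x <->
  forall e : R, 0 < e -> exists N, forall n, (N <= n)%N -> nrm (u n - x) < e.
Proof.
split=> [/cvgrPdist_lt ux e e0|h].
  have /ux [N _ HN] : (0 : R[i]) < e%:C by rewrite ltcR.
  exists N => n /HN /=; rewrite nrmE ltcR => *; by rewrite nrmBC.
apply/cvgrPdist_lt => e; rewrite ltcE /= => /andP[/eqP e1 e0].
have [N HN] := h _ e0; exists N => // n /HN /=; rewrite nrmBC => un.
by rewrite nrmE ltcE /= e1 eqxx.
Qed.

End norm.

Lemma cauchy_nrm_cvg {R : realType} {V : completeNormedModType R[i]}
    (u : V^nat) :
  (forall e : R, 0 < e -> exists N, forall n m, (N <= n)%N -> (n <= m)%N ->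
     nrm (u m - u n) < e) -> exists x : V, u @ \oo --> x.
Proof.
move=> h; apply/cvg_ex/cauchy_cvgP/cauchy_exP => e.
rewrite ltcE /= => /andP[/eqP e1 e0].
have [N HN] := h _ e0; exists (u N); exists N => // n /= Nn.
rewrite -ball_normE /ball_ /= -opprB normrN nrmE ltcE /= e1 eqxx /=.
exact: HN.
Qed.

Section inner_product.
Context {R : realType} {H : hilbertType R}.
Implicit Types x y z : H.

Lemma ipDl x y z : ip (x + y) z = ip x z + ip y z.
Proof. by rewrite linearDl. Qed.

Lemma ipDr x y z : ip x (y + z) = ip x y + ip x z.
Proof. by rewrite linearDr. Qed.

Lemma ipZl a x y : ip (a *: x) y = a * ip x y.
Proof. by rewrite linearZl_LR. Qed.

Lemma ipZr a x y : ip x (a *: y) = a^* * ip x y.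
Proof. by rewrite linearZr_LR. Qed.

Lemma ip_conj x y : ip x y = (ip y x)^*.
Proof. by rewrite hermC /= expr0 mul1r. Qed.

Lemma ip0l y : ip 0 y = 0 :> R[i].
Proof. by rewrite -(scale0r (0 : H)) ipZl mul0r. Qed.

Lemma ip0r y : ip y 0 = 0 :> R[i].
Proof. by rewrite ip_conj ip0l conjC0. Qed.

Lemma ipNl x y : ip (- x) y = - ip x y.
Proof. by rewrite -scaleN1r ipZl mulN1r. Qed.

Lemma ipBl x y z : ip (x - y) z = ip x z - ip y z.
Proof. by rewrite ipDl ipNl. Qed.

Lemma ipNr x y : ip x (- y) = - ip x y.
Proof. by rewrite ip_conj ipNl rmorphN /= -ip_conj. Qed.

Lemma ipBr x y z : ip x (y - z) = ip x y - ip x z.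
Proof. by rewrite ipDr ipNr. Qed.

Lemma ip_sqr x : ip x x = (nrm x ^+ 2)%:C.
Proof. by rewrite -normr_ip nrmE rmorphXn. Qed.

Lemma nrm_sqr x : nrm x ^+ 2 = complex.Re (ip x x).
Proof. by rewrite ip_sqr. Qed.

Lemma nrmD_sqr x y :
  nrm (x + y) ^+ 2 = nrm x ^+ 2 + nrm y ^+ 2 + 2 * complex.Re (ip x y).
Proof.
rewrite !nrm_sqr !ipDl !ipDr (ip_conj y x) !ReD ReC; ring.
Qed.

Lemma CauchySchwarz_ip x y : cabs (ip x y) <= nrm x * nrm y.
Proof.
have [y0|y0] := eqVneq (nrm y) 0.
  by rewrite (nrm_eq0 y0) ip0r cabs0 nrm0 mulr0.
pose n := nrm y ^+ 2; pose c := ip x y.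
have n0 : 0 < n by rewrite exprn_gt0 // lt_def y0 nrm_ge0.
(* This square equals [n (n |x|^2 - |c|^2)]; scaling [x] by [n = |y|^2] avoids a division. *)
have : 0 <= nrm (n%:C *: x - c *: y) ^+ 2 by rewrite exprn_ge0 ?nrm_ge0.
rewrite nrm_sqr ipBl !ipBr !ipZl !ipZr !ip_sqr -/n -/c (ip_conj y x) -/c.
have -> : n%:C * ((n%:C)^* * (nrm x ^+ 2)%:C) - n%:C * (c^* * c) -
    (c * ((n%:C)^* * c^*) - c * (c^* * n%:C)) =
    (n * (n * nrm x ^+ 2 - cabs c ^+ 2))%:C.
  have Y := mul_conj c; move: (cabs c ^+ 2) (nrm x ^+ 2) Y => Y X cE.
  clearbody n; have -> : (n * (n * X - Y))%:C = n%:C * (n%:C * X%:C - Y%:C).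
    by rewrite rmorphM /= rmorphB /= rmorphM.
  rewrite -cE conjR; ring.
rewrite /= pmulr_rge0 // subr_ge0 => h.
rewrite -(@ler_pXn2r _ 2) ?nnegrE ?cabs_ge0 ?mulr_ge0 ?nrm_ge0 //.
by rewrite exprMn mulrC.
Qed.

Lemma cvg_ipl (u : H^nat) x y : u @ \oo --> x ->
  forall e : R, 0 < e -> exists N, forall n, (N <= n)%N ->
    cabs (ip (u n) y - ip x y) < e.
Proof.
move=> /cvg_nrmP ux e e0.
have d0 : 0 < e / (nrm y + 1) by rewrite divr_gt0 // ltr_wpDl ?nrm_ge0.
have [N HN] := ux _ d0; exists N => n /HN; rewrite ltr_pdivlMr ?ltr_wpDl ?nrm_ge0 //.
apply: le_lt_trans; rewrite -ipBl (le_trans (CauchySchwarz_ip _ _)) //.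
by rewrite ler_wpM2l ?nrm_ge0 // lerDl.
Qed.

End inner_product.

(** * Projection-valued measures *)

Section projection_valued_measures.
Context {R : realType} {H : hilbertType R} {E : set (measurableTypeR R) -> H -> H}.
Hypothesis pE : projection_valued_measure E.
Implicit Types (A B : set (measurableTypeR R)) (f g : H).

Lemma pvmD B f g : measurable B -> E B (f + g) = E B f + E B g.
Proof.
by move=> mB; have := pvm_linear pE mB 1 f g; rewrite !scale1r.
Qed.

Lemma pvm0r B : measurable B -> E B 0 = 0.
Proof.
move=> mB; have := pvmD 0 0 mB; rewrite addr0 => /eqP.
by rewrite -subr_eq subrr => /eqP.
Qed.

Lemma pvmZ B a f : measurable B -> E B (a *: f) = a *: E B f.
Proof.
move=> mB; have := pvm_linear pE mB a f 0.
by rewrite pvm0r // !addr0.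
Qed.

Lemma pvmN B f : measurable B -> E B (- f) = - E B f.
Proof. by move=> mB; rewrite -scaleN1r pvmZ // scaleN1r. Qed.

Lemma pvmB B f g : measurable B -> E B (f - g) = E B f - E B g.
Proof. by move=> mB; rewrite pvmD // pvmN. Qed.

Lemma pvm_ip B f : measurable B -> ip (E B f) f = (nrm (E B f) ^+ 2)%:C.
Proof. by move=> mB; rewrite -ip_sqr -(pvm_sym pE mB) (pvm_idem pE). Qed.

(** Countable additivity along the constant sequence [set0] makes the multiples [n E(set0) f]
    converge; consecutive ones differ by [E(set0) f], which is therefore arbitrarily small. *)
Lemma pvm_set0 f : E set0 f = 0.
Proof.
have := @pvm_sigma_additive _ _ _ pE (fun=> set0) (fun=> measurable0).
move=> /(_ (@trivIset_set0 _ _ _) f).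
under eq_fun do rewrite sumr_const card_ord.
rewrite bigcup0 // => /cvg_nrmP h.
apply: nrm_small => e e0; have e2 : 0 < e / 2 by rewrite divr_gt0.
have [N HN] := h _ e2.
have := nrm_tri (E set0 f *+ N.+1) (E set0 f) (E set0 f *+ N).
rewrite mulrSr addrAC subrr add0r => /le_trans; apply.
rewrite -mulrSr [e]splitr ltW // ltrD //; first exact: HN.
by rewrite nrmBC; apply: HN.
Qed.

Lemma pvmU A B f : measurable A -> measurable B -> A `&` B = set0 ->
  E (A `|` B) f = E A f + E B f.
Proof.
move=> mA mB AB0.
have mF n : measurable (bigcup2 A B n) by case: n => [|[|n]] //=; exact: measurable0.
have tF : trivIset setT (bigcup2 A B) by rewrite -trivIset_bigcup2.
have := @pvm_sigma_additive _ _ _ pE _ mF tF f; rewrite bigcup2E => h.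
apply: (cvg_unique (@norm_hausdorff _ _)) h _.
apply: cvg_near_cst; exists 2%N => // n /= n2.
have -> : n = (n - 2).+2 by rewrite -addn2 subnK.
rewrite !big_ord_recl /= big1 ?addr0 => [|i _]; last exact: pvm_set0.
by [].
Qed.

(** As [E A + E B] is again a projection, the squared norms of [E A g] and [E B g] add up, so the
    real part of their inner product vanishes for every [g]. The choice [g = E B f] turns that real
    part into [|E A (E B f)|^2]. *)
Lemma pvm_disj A B f : measurable A -> measurable B -> A `&` B = set0 ->
  E A (E B f) = 0.
Proof.
move=> mA mB AB0.
have U g : complex.Re (ip (E A g) (E B g)) = 0.
  have mU : measurable (A `|` B) by exact: measurableU.
  have : complex.Re (ip (E (A `|` B) g) g) = nrm (E A g + E B g) ^+ 2.
    by rewrite pvm_ip //= pvmU.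
  rewrite nrmD_sqr pvmU // ipDl !pvm_ip // ReD /= => h; lra.
have := U (E B f); rewrite (pvm_idem pE) // pvm_ip //= => /eqP.
by rewrite sqrf_eq0 => /eqP; exact: nrm_eq0.
Qed.

Lemma pvmI A B f : measurable A -> measurable B ->
  E A (E B f) = E (A `&` B) f.
Proof.
move=> mA mB.
have mI : measurable (A `&` B) by exact: measurableI.
have -> : E B f = E (A `&` B) f + E (B `\` A) f.
  rewrite -pvmU //; first by rewrite setIC setUIDK.
    exact: measurableD.
  by apply/seteqP; split=> t // [[? ?] [? []]].
rewrite pvmD // [X in _ + X]pvm_disj ?addr0 //; last 2 first.
- exact: measurableD.
- by apply/seteqP; split=> t // [? []].
rewrite -{1}(setUIDK A B) pvmU //; last 2 first.
- exact: measurableD.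
- by apply/seteqP; split=> t // [[? ?] []].
rewrite (pvm_idem pE) // pvm_disj ?addr0 //; first exact: measurableD.
by apply/seteqP; split=> t // [[? ?] []].
Qed.

(* Unlike [spectral_mu], this is nonnegative on non-measurable sets too, as the
   library's interface of measures requires. *)
Definition specm of projection_valued_measure E := fun (f : H)
    (B : set (measurableTypeR R)) =>
  (nrm (E B f) ^+ 2)%:E : \bar R.

Lemma cvg_Re_ip (u : H^nat) x y : u @ \oo --> x ->
  (fun n => complex.Re (ip (u n) y)) @ \oo --> complex.Re (ip x y).
Proof.
move=> ux; apply/cvgrPdist_lt => e e0.
have [N HN] := cvg_ipl y ux e0; exists N => // n /HN; apply: le_lt_trans.
by rewrite distrC -ReN -ReD normr_Re_le.
Qed.

Lemma pvm_sigma (F : nat -> set (measurableTypeR R)) f :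
  (forall n, measurable (F n)) -> trivIset setT F ->
  (fun n => \sum_(0 <= k < n) nrm (E (F k) f) ^+ 2) @ \oo -->
  nrm (E (\bigcup_k F k) f) ^+ 2.
Proof.
move=> mF tF.
have := cvg_Re_ip (y := f) (@pvm_sigma_additive _ _ _ pE _ mF tF f).
rewrite pvm_ip /=; last exact: bigcup_measurable.
apply: cvg_trans; apply: near_eq_cvg; apply: nearW => n.
rewrite big_mkord.
elim/big_ind2: _ => [|x1 r1 x2 r2 <- <-|i _].
- by rewrite ip0l.
- by rewrite ipDl ReD.
- by rewrite pvm_ip.
Qed.

Lemma specm0 f : specm pE f set0 = 0%E.
Proof. by rewrite /specm pvm_set0 nrm0 expr0n. Qed.

Lemma specm_ge0 f B : (0 <= specm pE f B)%E.
Proof. by rewrite lee_fin sqr_ge0. Qed.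

Lemma specm_sigma_additive f : semi_sigma_additive (specm pE f).
Proof.
move=> F mF tF mUF; rewrite /specm.
under eq_fun do rewrite sumEFin.
by apply: cvg_EFin; [exact: nearW|exact: pvm_sigma].
Qed.

HB.instance Definition _ f := isMeasure.Build _ _ _ (specm pE f)
  (specm0 f) (specm_ge0 f) (@specm_sigma_additive f).

Lemma nrm_pvm_le B f : measurable B -> nrm (E B f) <= nrm f.
Proof.
move=> mB; have [->|f0] := eqVneq (nrm (E B f)) 0; first exact: nrm_ge0.
have {f0} f0 : 0 < nrm (E B f) by rewrite lt_def f0 nrm_ge0.
rewrite -(ler_pM2l f0) -expr2.
have := CauchySchwarz_ip (E B f) f.
by rewrite pvm_ip // cabsR ger0_norm // sqr_ge0.
Qed.

Lemma nrm_pvmI_le A B f : measurable A -> measurable B ->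
  nrm (E (A `&` B) f) <= nrm (E B f).
Proof. by move=> mA mB; rewrite -pvmI // nrm_pvm_le. Qed.

Lemma pvm_null_sub A B f : measurable A -> measurable B -> A `<=` B ->
  E B f = 0 -> E A f = 0.
Proof.
move=> mA mB AB B0; apply: nrm_eq0; apply/eqP; rewrite eq_le nrm_ge0 andbT.
by rewrite -(setIidl AB) (le_trans (nrm_pvmI_le f mA mB)) // B0 nrm0.
Qed.

End projection_valued_measures.

(** * Spectral calculus *)

Section borel_functions.
Context {R : realType}.
Implicit Types (phi a : measurableTypeR R -> R[i]) (B : set (measurableTypeR R)).

Definition borel phi :=
  measurable_fun setT (fun t => complex.Re (phi t)) /\
  measurable_fun setT (fun t => complex.Im (phi t)).

Definition small phi (d : R) B :=
  forall s t, B s -> B t -> cabs (phi s - phi t) <= d.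

Definition countable_partition (F : nat -> set (measurableTypeR R)) :=
  [/\ forall n, measurable (F n), trivIset setT F & \bigcup_n F n = setT].

Lemma cabs_le_ReIm (z : R[i]) : cabs z <= `|complex.Re z| + `|complex.Im z|.
Proof.
rewrite -(@ler_pXn2r _ 2) ?nnegrE ?cabs_ge0 ?addr_ge0 // cabs_sqr sqrrD.
rewrite !real_normK ?num_real // -addrA [X in _ <= _ + X]addrC addrA lerDl.
by rewrite mulrn_wge0 // mulr_ge0.
Qed.

(** The plane is cut into half-open squares of side [d / 2]. A cell is the preimage of one square,
    numbered by the code of its integer corner; numbers that code no corner give empty cells. *)
Lemma borel_partition phi (d : R) : borel phi -> 0 < d ->
  exists2 F, countable_partition F & forall n, small phi d (F n).
Proof.
move=> [mRe mIm] d0; pose e := d / 2.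
have e0 : 0 < e by rewrite divr_gt0.
pose fl (x : R) := Num.floor (x / e).
have mfl (g : measurableTypeR R -> R) m : measurable_fun setT g ->
    measurable [set t | fl (g t) = m].
  move=> mg; have -> : [set t | fl (g t) = m] =
      setT `&` g @^-1` [set` `[m%:~R * e, (m + 1)%:~R * e[].
    apply/seteqP; split=> t /=.
      move=> <-; split => //; rewrite in_itv /= -ler_pdivlMr // -ltr_pdivrMr //.
      exact: floor_itv.
    rewrite in_itv /= -ler_pdivlMr // -ltr_pdivrMr // => -[_].
    by rewrite -floor_eq => /eqP.
  by apply: mg => //; exact: measurable_itv.
have flP (x y : R) : fl x = fl y -> `|x - y| <= e.
  move=> xy; have /andP[x1 x2] := floor_itv (x / e).
  have /andP[] := floor_itv (y / e); rewrite -/(fl y) -xy /fl => y1 y2.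
  have : `|x / e - y / e| <= 1.
    by rewrite ler_norml; move: x1 x2 y1 y2; rewrite intrD mulr1z; lra.
  by rewrite -mulrBl normrM (gtr0_norm (_ : 0 < e^-1)) ?invr_gt0 // ler_pdivrMr // mul1r.
pose code t : int * int := (fl (complex.Re (phi t)), fl (complex.Im (phi t))).
pose F n := [set t | pickle (code t) = n].
exists F; last first.
  move=> n s t <- /(pcan_inj (@pickleK _)) [] /flP h1 /flP h2.
  rewrite (le_trans (cabs_le_ReIm _)) // ReD ReN ImD ImN.
  by rewrite distrC [X in _ + X]distrC [leRHS]splitr lerD.
split.
- move=> n; have [[[a b] ab]|nn] := pselect (exists ab : int * int, pickle ab = n).
    have -> : F n = [set t | fl (complex.Re (phi t)) = a] `&`
        [set t | fl (complex.Im (phi t)) = b].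
      rewrite /F -ab; apply/seteqP; split=> t /=.
        by move/(pcan_inj (@pickleK _)) => [].
      by rewrite /code => -[-> ->].
    by apply: measurableI; exact: mfl.
  have Fn0 : F n = set0.
    by apply/seteqP; split=> t // tn; apply: nn; exists (code t).
  by rewrite Fn0; exact: measurable0.
- by move=> i j _ _ [t []]; rewrite /F /= => -> ->.
- by apply/seteqP; split=> t // _; exists (pickle (code t)).
Qed.

Definition sigma_sum (m : set (measurableTypeR R) -> R) :=
  forall F, (forall n, measurable (F n)) -> trivIset setT F ->
  (fun n => \sum_(0 <= k < n) m (F k)) @ \oo --> m (\bigcup_k F k).

Lemma sigma_sumD m1 m2 : sigma_sum m1 -> sigma_sum m2 ->
  sigma_sum (fun B => m1 B + m2 B).
Proof.
move=> s1 s2 F mF tF.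
under eq_fun do rewrite big_split /=.
by apply: cvgD; [exact: s1|exact: s2].
Qed.

Lemma sigma_sumZ c m : sigma_sum m -> sigma_sum (fun B => c * m B).
Proof.
move=> s F mF tF; under eq_fun do rewrite -mulr_sumr.
by apply: cvgMr; exact: s.
Qed.

Lemma le_over_partition m1 m2 F B : sigma_sum m1 -> sigma_sum m2 ->
  countable_partition F -> measurable B ->
  (forall n, m1 (B `&` F n) <= m2 (B `&` F n)) -> m1 B <= m2 B.
Proof.
move=> s1 s2 [mF tF cF] mB h.
have mBF n : measurable (B `&` F n) by exact: measurableI.
have tBF : trivIset setT (fun n => B `&` F n).
  by move=> i j _ _ [t [[_ ti] [_ tj]]]; apply: tF => //; exists t.
have -> : B = \bigcup_n (B `&` F n) by rewrite -setI_bigcupr cF setIT.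
apply: ler_cvg_to (s1 _ mBF tBF) (s2 _ mBF tBF) _.
by apply: nearW => n; apply: ler_sum => i _; apply: h.
Qed.

(** The localization principle behind the calculus: with both sides built from terms [|E B v|^2], a
    Borel function may be treated as constant up to an error [d]. *)
Lemma le_by_partition m1 m2 phi d B : sigma_sum m1 -> sigma_sum m2 ->
  borel phi -> 0 < d -> measurable B ->
  (forall B', measurable B' -> B' `<=` B -> small phi d B' -> m1 B' <= m2 B') ->
  m1 B <= m2 B.
Proof.
move=> s1 s2 mphi d0 mB h.
have [F pF sF] := borel_partition mphi d0.
apply: (le_over_partition s1 s2 pF mB) => n; have [mF _ _] := pF.
by apply: h => //; [exact: measurableI|move=> s t [_ ?] [_ ?]; exact: (sF n)].
Qed.

Lemma ler_addsmall (x y C : R) : 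
  (forall e, 0 < e -> e <= 1 -> x <= y + e * C) -> x <= y.
Proof.
move=> h; have C0 : 0 < `|C| + 1 by rewrite ltr_wpDl.
apply/ler_addgt0Pr => e e0.
pose e' := Num.min 1 (e / (`|C| + 1)).
have e'0 : 0 < e' by rewrite lt_min ltr01 divr_gt0.
apply: le_trans (h e' e'0 _) _; first by rewrite ge_min lexx.
rewrite lerD2l (le_trans (ler_norm _)) // normrM (gtr0_norm e'0).
have : e' <= e / (`|C| + 1) by rewrite ge_min lexx orbT.
rewrite ler_pdivlMr //; apply: le_trans.
by rewrite ler_wpM2l ?(ltW e'0) // lerDl.
Qed.

(** Norms are not additive in the spectral set but their squares are, so an error linear in [d] has
    to be restated for squares. With [S = K (p + q)] the constants come from [2 A S <= A^2 + S^2],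
    [d S^2 <= S^2] and [S^2 <= 2 K^2 (p^2 + q^2)]. *)
Lemma sqr_perturb (d K x A p q : R) : 0 <= d -> d <= 1 -> 0 <= x -> 0 <= A ->
  0 <= K -> 0 <= p -> 0 <= q -> x <= A + d * (K * (p + q)) ->
  x ^+ 2 <= A ^+ 2 + d * (A ^+ 2 + 4 * K ^+ 2 * (p ^+ 2 + q ^+ 2)).
Proof.
move=> d0 d1 x0 A0 K0 p0 q0.
have S0 : 0 <= K * (p + q) by rewrite mulr_ge0 // addr_ge0.
have S2 : (K * (p + q)) ^+ 2 <= 2 * K ^+ 2 * (p ^+ 2 + q ^+ 2).
  have -> : 2 * K ^+ 2 * (p ^+ 2 + q ^+ 2) =
    (K * (p + q)) ^+ 2 + (K * (p - q)) ^+ 2 by ring.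
  by rewrite lerDl sqr_ge0.
have -> : 4 * K ^+ 2 * (p ^+ 2 + q ^+ 2) = 2 * (2 * K ^+ 2 * (p ^+ 2 + q ^+ 2)).
  by ring.
move: (2 * K ^+ 2 * _) S2 => Q.
move: (K * (p + q)) S0 => S S0 S2 xle.
have : x ^+ 2 <= (A + d * S) ^+ 2.
  by rewrite ler_pXn2r // nnegrE addr_ge0 // mulr_ge0.
move=> /le_trans; apply.
have -> : (A + d * S) ^+ 2 = A ^+ 2 + d * (2 * A * S + d * S ^+ 2) by ring.
rewrite lerD2l ler_wpM2l //.
have : d * S ^+ 2 <= S ^+ 2 by rewrite ler_piMl // sqr_ge0.
have := sqr_ge0 (A - S); nra.
Qed.

End borel_functions.

(** * Local characterization of [phi(A) f] *)

Section calculus.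
Context {R : realType} {H : hilbertType R} {E : set (measurableTypeR R) -> H -> H}.
Hypothesis pE : projection_valued_measure E.
Implicit Types (A B : set (measurableTypeR R)) (f g u v : H).
Implicit Types (phi psi a : measurableTypeR R -> R[i]).

Lemma sigma_sum_pvm f : sigma_sum (fun B => nrm (E B f) ^+ 2).
Proof. by move=> F mF tF; exact: pvm_sigma. Qed.

(* [applies phi f u] states that [f] is in the domain of [phi(A)] and
   [u = phi(A) f]: where [phi] is within [e] of a constant [c], [u] is within [e]
   of [c f]. *)
Definition applies phi f u := forall B (c : R[i]) (e : R), measurable B ->
  0 <= e -> (forall t, B t -> cabs (phi t - c) <= e) ->
  nrm (E B (u - c *: f)) <= e * nrm (E B f).

(** Partitioning twice separates two choices. Cells of oscillation at most 1 provide a bound [M] for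
    [a] and [phi], which fixes [K]; each is then cut into cells of oscillation [d], and [d] tends to
    0 with [K] unchanged. This is what allows [a] and [phi] to be unbounded. The vectors [z1] and
    [z2] carry the error as a countably additive quantity. *)
Lemma applies_crit phi a f u z1 z2 : borel phi -> borel a ->
  (forall M, 0 <= M -> exists2 K, 0 <= K & forall d B t0,
    0 < d <= 1 -> measurable B -> B t0 ->
    small a d B -> small phi d B -> cabs (a t0) <= M -> cabs (phi t0) <= M ->
    nrm (E B (u - phi t0 *: f)) <= d * K * (nrm (E B z1) + nrm (E B z2))) ->
  applies phi f u.
Proof.
move=> mphi ma h B c e mB e0 phic.
suff : nrm (E B (u - c *: f)) ^+ 2 <= e ^+ 2 * nrm (E B f) ^+ 2.
  by rewrite -exprMn ler_pXn2r // nnegrE ?mulr_ge0 ?nrm_ge0.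
pose m v C := nrm (E C v) ^+ 2.
have sm v : sigma_sum (m v) by exact: sigma_sum_pvm.
pose m2 C := e ^+ 2 * m f C.
have sm2 : sigma_sum m2 by exact: sigma_sumZ.
change (m (u - c *: f) B <= m2 B).
apply: (le_by_partition (sm _) sm2 ma ltr01 mB) => B1 mB1 B1B sa1.
apply: (le_by_partition (sm _) sm2 mphi ltr01 mB1) => B2 mB2 B21 sp2.
have [[t1 B2t1]|/set0P/negP/negPn/eqP ->] := pselect (B2 !=set0); last first.
  by rewrite /m2 /m !pvm_set0 // !nrm0 expr0n mulr0.
pose M := cabs (a t1) + cabs (phi t1) + 1.
have M0 : 0 <= M by rewrite !addr_ge0 ?cabs_ge0.
have [K K0 hK] := h M M0.
pose m3 C := m2 C + 4 * K ^+ 2 * (m z1 C + m z2 C).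
have sm3 : sigma_sum m3.
  by apply: sigma_sumD => //; apply: sigma_sumZ; exact: sigma_sumD.
apply: (@ler_addsmall _ _ _ (m3 B2)) => d d0 d1.
pose m4 C := m2 C + d * m3 C.
have sm4 : sigma_sum m4 by apply: sigma_sumD => //; exact: sigma_sumZ.
change (m (u - c *: f) B2 <= m4 B2).
apply: (le_by_partition (sm _) sm4 ma d0 mB2) => B3 mB3 B32 sa3.
apply: (le_by_partition (sm _) sm4 mphi d0 mB3) => B4 mB4 B43 sp4.
rewrite /m4 /m3 /m2 /m.
have [[t0 B4t0]|/set0P/negP/negPn/eqP ->] := pselect (B4 !=set0); last first.
  by rewrite !pvm_set0 // !nrm0 expr0n !(mulr0, addr0).
have B4B t : B4 t -> B2 t by move=> /B43/B32.
have h1 : nrm (E B4 (u - phi t0 *: f)) <= d * K * (nrm (E B4 z1) + nrm (E B4 z2)).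
  apply: hK => //; first by rewrite d0.
  - by move=> s t /B43 ? /B43 ?; exact: sa3.
  - rewrite (le_trans (ler_cabs_sub _ (a t1))) // /M.
    have : cabs (a t0 - a t1) <= 1 by apply: sa1; [apply/B21/B4B|apply/B21].
    have := cabs_ge0 (phi t1); lra.
  - rewrite (le_trans (ler_cabs_sub _ (phi t1))) // /M.
    have : cabs (phi t0 - phi t1) <= 1 by apply: sp2 => //; apply/B4B.
    have := cabs_ge0 (a t1); lra.
have h2 : nrm (E B4 (u - c *: f)) <= e * nrm (E B4 f) + nrm (E B4 (u - phi t0 *: f)).
  have -> : u - c *: f = (phi t0 - c) *: f + (u - phi t0 *: f).
    by rewrite scalerBl [RHS]addrC subrKA.
  rewrite [X in nrm X <= _](pvmD pE) // (le_trans (nrmD _ _)) // lerD2r pvmZ // nrmZ.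
  by rewrite ler_wpM2r ?nrm_ge0 // phic //; apply/B1B/B21/B4B.
rewrite -exprMn; apply: sqr_perturb; rewrite ?mulr_ge0 ?nrm_ge0 ?(ltW d0) //.
by apply: le_trans h2 _; rewrite lerD2l mulrA.
Qed.

End calculus.

Arguments applies {R H} E phi f u.

Section borel_closure.
Context {R : realType}.
Implicit Types (phi psi : measurableTypeR R -> R[i]).

Lemma borel_real (g : measurableTypeR R -> R) :
  measurable_fun setT g -> borel (fun t => (g t)%:C).
Proof. by move=> mg; split => //=; exact: measurable_cst. Qed.

Lemma borel_cst (c : R[i]) : borel (fun=> c).
Proof. by split; exact: measurable_cst. Qed.

Lemma borelD phi psi : borel phi -> borel psi -> borel (fun t => phi t + psi t).
Proof.
move=> [r1 i1] [r2 i2]; split.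
- under eq_fun do rewrite ReD; exact: measurable_funD.
- under eq_fun do rewrite ImD; exact: measurable_funD.
Qed.

Lemma borelM phi psi : borel phi -> borel psi -> borel (fun t => phi t * psi t).
Proof.
move=> [r1 i1] [r2 i2]; split.
- under eq_fun do rewrite ReM.
  by apply: measurable_funB; exact: measurable_funM.
- under eq_fun do rewrite ImM.
  by apply: measurable_funD; exact: measurable_funM.
Qed.

Lemma borelV phi : borel phi -> borel (fun t => (phi t)^-1).
Proof.
move=> [r1 i1].
have m2 : measurable_fun setT
    (fun t => (complex.Re (phi t) ^+ 2 + complex.Im (phi t) ^+ 2)^-1).
  rewrite (_ : (fun _ => _) = (@powR R)^~ (-1) \o
      fun t => complex.Re (phi t) ^+ 2 + complex.Im (phi t) ^+ 2).
    apply: measurableT_comp; first exact: measurable_powR.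
    by apply: measurable_funD; exact: measurable_funX.
  by apply/funext => t /=; rewrite powR_inv1 // addr_ge0 // sqr_ge0.
split.
- rewrite (_ : (fun _ => _) = fun t => complex.Re (phi t) *
    (complex.Re (phi t) ^+ 2 + complex.Im (phi t) ^+ 2)^-1).
    exact: measurable_funM.
  by apply/funext => t; case: (phi t).
- rewrite (_ : (fun _ => _) = fun t => - complex.Im (phi t) *
    (complex.Re (phi t) ^+ 2 + complex.Im (phi t) ^+ 2)^-1).
    by apply: measurable_funM => //; exact: measurableT_comp.
  by apply/funext => t; case: (phi t) => a b /=; rewrite mulNr.
Qed.

Lemma borel_indic (C : set (measurableTypeR R)) :
  measurable C -> borel (fun t => (\1_C t)%:C).
Proof. by move=> mC; apply: borel_real; exact: measurable_indic. Qed.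

Lemma measurable_cabs phi : borel phi -> measurable_fun setT (fun t => cabs (phi t)).
Proof.
move=> [r1 i1]; rewrite (_ : (fun _ => _) =
  (@powR R)^~ 2^-1 \o
  (fun t => complex.Re (phi t) ^+ 2 + complex.Im (phi t) ^+ 2)).
  apply: measurableT_comp; first exact: measurable_powR.
  by apply: measurable_funD; exact: measurable_funX.
by apply/funext => t /=; rewrite cabsE powR12_sqrt // addr_ge0 // sqr_ge0.
Qed.

End borel_closure.

Section operator_algebra.
Context {R : realType} {H : hilbertType R} {E : set (measurableTypeR R) -> H -> H}.
Hypothesis pE : projection_valued_measure E.
Implicit Types (A B C : set (measurableTypeR R)) (f g u v : H).
Implicit Types (phi psi a b : measurableTypeR R -> R[i]).

Lemma applies_lin phi (c : R[i]) f g u v : borel phi ->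
  applies E phi f u -> applies E phi g v ->
  applies E phi (c *: f + g) (c *: u + v).
Proof.
move=> mphi fu gv.
apply: (applies_crit pE (a := phi) (z1 := f) (z2 := g)) => // M M0.
exists (cabs c + 1); first by rewrite addr_ge0 ?cabs_ge0.
move=> d B t0 /andP[d0 _] mB Bt0 sphi _ _ _.
have -> : c *: u + v - phi t0 *: (c *: f + g) =
    c *: (u - phi t0 *: f) + (v - phi t0 *: g).
  by rewrite scalerDr opprD addrACA scalerBr !scalerA [c * _]mulrC.
have sphi' t : B t -> cabs (phi t - phi t0) <= d by move=> Bt; exact: sphi.
rewrite (pvmD pE) // (pvmZ pE) // (le_trans (nrmD _ _)) // nrmZ.
have h1 := fu B (phi t0) d mB (ltW d0) sphi'.
have h2 := gv B (phi t0) d mB (ltW d0) sphi'.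
have := cabs_ge0 c; have := nrm_ge0 (E B f); have := nrm_ge0 (E B g).
move=> ng nf c0; apply: le_trans (lerD (ler_wpM2l c0 h1) h2) _.
have := mulr_ge0 (ltW d0) nf; have := mulr_ge0 (mulr_ge0 (ltW d0) c0) ng; nra.
Qed.

(* The factors may be unbounded: the criterion only tests sets on which both
   are bounded, and there the defect is linear in their oscillation. *)
Lemma applies_comp a b f u v : borel a -> borel b ->
  applies E a f u -> applies E (fun t => b t * a t) f v -> applies E b u v.
Proof.
move=> ma mb fu fv.
apply: (applies_crit pE (a := a) (z1 := f) (z2 := f)) => // M M0.
exists (3 * M + 1); first by rewrite addr_ge0 ?mulr_ge0.
move=> d B t0 /andP[d0 d1] mB Bt0 sa sb aM bM.
have sa' t : B t -> cabs (a t - a t0) <= d by move=> Bt; exact: sa.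
have h1 := fu B (a t0) d mB (ltW d0) sa'.
have h2 : nrm (E B (v - (b t0 * a t0) *: f)) <= (d * (2 * M + 1)) * nrm (E B f).
  apply: fv => // [|t Bt]; first by rewrite (mulr_ge0 (ltW d0)) // addr_ge0 // mulr_ge0.
  have -> : b t * a t - b t0 * a t0 =
    (b t - b t0) * (a t - a t0) + b t0 * (a t - a t0) + (b t - b t0) * a t0 by ring.
  apply: le_trans (cabsD _ _) _; apply: le_trans (lerD (cabsD _ _) (lexx _)) _.
  rewrite !cabsM; have := sb _ _ Bt Bt0; have := sa' _ Bt.
  have := cabs_ge0 (b t - b t0); have := cabs_ge0 (a t - a t0).
  have := cabs_ge0 (b t0); have := cabs_ge0 (a t0); move: aM bM.
  move: (cabs _) (cabs _) (cabs _) (cabs _) => w x y z.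
  move=> wM xM w0 x0 y0 z0 yd zd; nra.
have -> : v - b t0 *: u = (v - (b t0 * a t0) *: f) - b t0 *: (u - a t0 *: f).
  by rewrite scalerBr scalerA opprB addrA addrNK.
rewrite (pvmB pE) // (pvmZ pE) // (le_trans (nrmD _ _)) // nrmN nrmZ.
have n0 := nrm_ge0 (E B f); have b0 := cabs_ge0 (b t0).
have h3 := le_trans (ler_wpM2l b0 h1) (ler_wpM2r (mulr_ge0 (ltW d0) n0) bM).
apply: le_trans (lerD h2 h3) _.
have := mulr_ge0 (ltW d0) n0; have := mulr_ge0 (mulr_ge0 (ltW d0) n0) M0; nra.
Qed.

Lemma applies_shift phi (c : R[i]) f u :
  applies E phi f u -> applies E (fun t => phi t + c) f (u + c *: f).
Proof.
move=> fu B c' e mB e0 h.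
have -> : u + c *: f - c' *: f = u - (c' - c) *: f.
  by rewrite scalerBl opprB addrA.
by apply: fu => // t Bt; rewrite opprB addrA; exact: h.
Qed.

Lemma applies_cst (c : R[i]) f : applies E (fun=> c) f (c *: f).
Proof.
move=> B c' e mB e0 h; rewrite -scalerBl (pvmZ pE) // nrmZ.
have [[t Bt]|/set0P/negP/negPn/eqP ->] := pselect (B !=set0).
  by rewrite ler_wpM2r ?nrm_ge0 // (h t).
by rewrite pvm_set0 // nrm0 !mulr0.
Qed.

Lemma applies_ae phi psi N f u : measurable N -> (forall g, E N g = 0) ->
  (forall t, ~ N t -> phi t = psi t) -> applies E phi f u -> applies E psi f u.
Proof.
move=> mN N0 e fu B c eps mB e0 h.
have EB g : E B g = E (B `\` N) g.
  rewrite -{1}(setUIDK B N) (pvmU pE) //; last 3 first.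
  - exact: measurableI.
  - exact: measurableD.
  - by apply/seteqP; split=> t // [[? ?] []].
  by rewrite -(pvmI pE) // N0 (pvm0r pE) // add0r.
rewrite !EB; apply: fu => //; first exact: measurableD.
by move=> t [Bt /e ->]; exact: h.
Qed.

Lemma applies_indic C f : measurable C ->
  applies E (fun t => (\1_C t)%:C) f (E C f).
Proof.
move=> mC; have mI := borel_indic mC.
apply: (applies_crit pE (a := fun=> 0) (z1 := f) (z2 := f)) => //.
move=> M M0; exists 1 => // d B t0 /andP[d0 d1] mB Bt0 _ sphi _ _.
have nB := nrm_ge0 (E B f).
(* A function with values 0 and 1 that oscillates by at most [d < 1] is constant on [B], so the
   defect vanishes there; only [d = 1] needs an estimate. *)
have [d1'|d1'] := eqVneq d 1.
  rewrite d1' !mul1r (pvmB pE) // (pvmZ pE) // (le_trans (nrmD _ _)) // nrmN nrmZ lerD //.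
    by rewrite (pvmI pE) // setIC nrm_pvmI_le.
  by rewrite cabsR ler_piMl // indicE; case: (_ \in _); rewrite ?normr1 ?normr0.
have {d1 d1'} d1 : d < 1 by rewrite lt_neqAle d1'.
have BC t : B t -> (t \in C) = (t0 \in C).
  move=> Bt; have := sphi _ _ Bt Bt0; rewrite -rmorphB /= cabsR !indicE.
  case: (t \in C); case: (t0 \in C) => //.
    by rewrite subr0 normr1 => /le_lt_trans/(_ d1); rewrite ltxx.
  by rewrite sub0r normrN1 => /le_lt_trans/(_ d1); rewrite ltxx.
rewrite (pvmB pE) // (pvmZ pE) // (pvmI pE) // indicE.
have [Ct0|Ct0] := boolP (t0 \in C).
  have -> : B `&` C = B.
    by apply/setIidl => t Bt; apply/set_mem; rewrite BC.
  by rewrite scale1r subrr nrm0 !mulr_ge0 ?addr_ge0 ?(ltW d0).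
have -> : B `&` C = set0.
  by apply/seteqP; split=> t // [Bt /mem_set]; rewrite BC // (negbTE Ct0).
by rewrite pvm_set0 // scale0r subrr nrm0 !mulr_ge0 ?addr_ge0 ?(ltW d0).
Qed.

Lemma applies_le phi (s : R) f u : applies E phi f u ->
  (forall t, cabs (phi t) <= s) -> nrm u <= s * nrm f.
Proof.
move=> fu h; have s0 : 0 <= s by exact: le_trans (cabs_ge0 _) (h 0).
have := fu setT 0 s measurableT s0; rewrite scale0r subr0 !(pvm_setT pE).
by apply => t _; rewrite subr0.
Qed.

Lemma applies_supp phi C f u : measurable C -> applies E phi f u ->
  (forall t, ~ C t -> phi t = 0) -> E C u = u.
Proof.
move=> mC fu h; have mC' := measurableC mC.
have : nrm (E (~` C) u) <= 0.
  have := fu (~` C) 0 0 mC' (lexx _); rewrite scale0r subr0 mul0r; apply.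
  by move=> t /h ->; rewrite subr0 cabs0.
move=> uC; have {uC} uC : E (~` C) u = 0.
  by apply: nrm_eq0; apply/eqP; rewrite eq_le uC nrm_ge0.
rewrite -[RHS](pvm_setT pE) -(setUv C) (pvmU pE) ?setICr // uC addr0 //.
Qed.

End operator_algebra.

Arguments applies_shift {R H E phi} c {f u}.

(** * The norm of [phi(A) f] as an integral *)

Section spectral_integrals.
Context {R : realType} {H : hilbertType R} {E : set (measurableTypeR R) -> H -> H}.
Hypothesis pE : projection_valued_measure E.
Implicit Types (A B C : set (measurableTypeR R)) (f g u v : H).
Implicit Types (phi psi a b : measurableTypeR R -> R[i]).

Definition sqint phi f B : \bar R :=
  (\int[specm pE f]_(t in B) (cabs (phi t) ^+ 2)%:E)%E.

Lemma measurable_cabs_sqr phi B : borel phi ->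
  measurable_fun B (fun t => (cabs (phi t) ^+ 2)%:E).
Proof.
move=> mphi; apply: (measurable_funS measurableT (@subsetT _ _)).
by apply/measurable_EFinP; apply: measurable_funX; exact: measurable_cabs.
Qed.

Lemma sqint_ge0 phi f B : (0 <= sqint phi f B)%E.
Proof. by apply: integral_ge0 => t _; rewrite lee_fin sqr_ge0. Qed.

Lemma sqint_le_cst phi f B (s : R) : borel phi -> measurable B ->
  (forall t, B t -> cabs (phi t) <= s) ->
  (sqint phi f B <= (s ^+ 2 * nrm (E B f) ^+ 2)%:E)%E.
Proof.
move=> mphi mB h; rewrite EFinM -[X in (_ * X)%E]/(specm pE f B).
rewrite -integral_cst //; apply: ge0_le_integral => //.
- by move=> t _; rewrite lee_fin sqr_ge0.
- exact: measurable_cabs_sqr.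
- move=> t Bt; rewrite lee_fin ler_pXn2r ?nnegrE ?cabs_ge0 ?h //.
  exact: le_trans (cabs_ge0 _) (h _ Bt).
Qed.

Lemma sqint_ge_cst phi f B (s : R) : borel phi -> measurable B -> 0 <= s ->
  (forall t, B t -> s <= cabs (phi t)) ->
  ((s ^+ 2 * nrm (E B f) ^+ 2)%:E <= sqint phi f B)%E.
Proof.
move=> mphi mB s0 h; rewrite EFinM -[X in (_ * X)%E]/(specm pE f B).
rewrite -integral_cst //; apply: ge0_le_integral => //.
- by move=> t _; rewrite lee_fin sqr_ge0.
- exact: measurable_cabs_sqr.
- by move=> t Bt; rewrite lee_fin ler_pXn2r ?nnegrE ?cabs_ge0 ?h.
Qed.

Lemma sqint_partition phi f F : borel phi -> countable_partition F ->
  sqint phi f setT = (\sum_(0 <= n <oo) sqint phi f (F n))%E.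
Proof.
move=> mphi [mF tF cF]; rewrite /sqint -cF ge0_integral_bigcup //.
- exact: measurable_cabs_sqr.
- by move=> t _; rewrite lee_fin sqr_ge0.
Qed.

Lemma nrm_sqr_partition f F : countable_partition F ->
  (nrm f ^+ 2)%:E = (\sum_(0 <= n <oo) (nrm (E (F n) f) ^+ 2)%:E)%E.
Proof.
move=> [mF tF cF]; rewrite -{1}(pvm_setT pE f).
rewrite -[LHS]/(specm pE f setT) -cF measure_semi_bigcup // cF.
exact: measurableT.
Qed.

Lemma sqint_cell phi f u d D : borel phi -> measurable D -> 0 < d <= 1 ->
  small phi d D -> applies E phi f u ->
  (sqint phi f D <= ((1 + d) * nrm (E D u) ^+ 2 + 16 * d * nrm (E D f) ^+ 2)%:E /\
   (nrm (E D u) ^+ 2)%:E <=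
     (1 + d)%:E * sqint phi f D + (16 * d * nrm (E D f) ^+ 2)%:E)%E.
Proof.
move=> mphi mD /andP[d0 d1] sD fu.
have [[t0 Dt0]|/set0P/negP/negPn/eqP ->] := pselect (D !=set0); last first.
  by rewrite /sqint integral_set0 !pvm_set0 // nrm0 expr0n /= !mulr0 mule0 adde0.
set r := cabs (phi t0); set al := nrm (E D f); set be := nrm (E D u).
have r0 : 0 <= r := cabs_ge0 _.
have al0 : 0 <= al := nrm_ge0 _.
have be0 : 0 <= be := nrm_ge0 _.
have h := fu D (phi t0) d mD (ltW d0) (fun t Dt => sD _ _ Dt Dt0).
have lo t : D t -> Num.max 0 (r - d) <= cabs (phi t).
  move=> Dt; rewrite ge_max cabs_ge0 lerBlDl /=.
  by rewrite (le_trans (ler_cabs_sub _ (phi t))) // lerD2r sD.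
have hi t : D t -> cabs (phi t) <= r + d.
  move=> Dt; rewrite addrC.
  by rewrite (le_trans (ler_cabs_sub _ (phi t0))) // lerD2r sD.
have ube : be <= r * al + d * al.
  have -> : be = nrm (E D (u - phi t0 *: f) + phi t0 *: E D f).
    by rewrite (pvmB pE) // (pvmZ pE) // subrK.
  by rewrite (le_trans (nrmD _ _)) // nrmZ addrC lerD2l.
have lbe : r * al <= be + d * al.
  have -> : r * al = nrm (E D u - E D (u - phi t0 *: f)).
    by rewrite (pvmB pE) // (pvmZ pE) // subKr nrmZ.
  by rewrite (le_trans (nrmD _ _)) // nrmN lerD2l.
(* [sqr_perturb] is used with [K = 1], [p = 2 al], [q = 0]: the vector and the value of [|phi|] are
   each off by [d], whence the 2, and [4 * 2^2 = 16]. *)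
have al16 : 4 * 1 ^+ 2 * ((2 * al) ^+ 2 + 0 ^+ 2) = 16 * al ^+ 2 by ring.
split.
  apply: le_trans (sqint_le_cst f mphi mD hi) _; rewrite lee_fin -exprMn.
  have -> : (1 + d) * be ^+ 2 + 16 * d * al ^+ 2 =
    be ^+ 2 + d * (be ^+ 2 + 16 * al ^+ 2) by ring.
  rewrite -al16; apply: sqr_perturb; rewrite ?mulr_ge0 ?addr_ge0 ?(ltW d0) //.
  by rewrite mul1r addr0 mulrDl; move: lbe; lra.
pose m := Num.max 0 (r - d); have m0 : 0 <= m by rewrite le_max lexx.
have rm : r <= m + d by rewrite -lerBlDr le_max lexx orbT.
have -> : ((1 + d)%:E * sqint phi f D + (16 * d * al ^+ 2)%:E)%E =
    ((16 * d * al ^+ 2)%:E + (1 + d)%:E * sqint phi f D)%E by rewrite addeC.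
have := sqint_ge_cst f mphi mD m0 lo; rewrite -/al => hm.
have : ((1 + d)%:E * (m ^+ 2 * al ^+ 2)%:E <= (1 + d)%:E * sqint phi f D)%E.
  by apply: lee_wpmul2l => //; rewrite lee_fin addr_ge0 // ltW.
move=> /(leeD2l (16 * d * al ^+ 2)%:E); apply: le_trans.
rewrite -EFinM -EFinD lee_fin -exprMn.
have -> : 16 * d * al ^+ 2 + (1 + d) * (m * al) ^+ 2 =
  (m * al) ^+ 2 + d * ((m * al) ^+ 2 + 16 * al ^+ 2) by ring.
rewrite -al16; apply: sqr_perturb; rewrite ?mulr_ge0 ?(ltW d0) //.
rewrite mul1r addr0; apply: le_trans ube _.
by have := ler_wpM2r al0 rm; rewrite mulrDl; lra.
Qed.

(** The cell estimates are summed over a partition and [d] tends to 0. The case [d = 1] comes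
    beforehand: it shows that the integral is finite, so that the limit can be taken among real
    numbers. *)
Lemma sqint_applies phi f u : borel phi -> applies E phi f u ->
  sqint phi f setT = (nrm u ^+ 2)%:E.
Proof.
move=> mphi fu.
have bounds d : 0 < d -> d <= 1 ->
  (sqint phi f setT <= ((1 + d) * nrm u ^+ 2 + 16 * d * nrm f ^+ 2)%:E /\
   (nrm u ^+ 2)%:E <=
     (1 + d)%:E * sqint phi f setT + (16 * d * nrm f ^+ 2)%:E)%E.
  move=> d0 d1; have d01 : 0 < d <= 1 by rewrite d0.
  have [F pF sF] := borel_partition mphi d0; have [mF _ _] := pF.
  have cell n := sqint_cell mphi (mF n) d01 (sF n) fu.
  have sq0 v n : (0 <= (nrm (E (F n) v) ^+ 2)%:E)%E by rewrite lee_fin sqr_ge0.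
  have d10 : 0 <= 1 + d by rewrite addr_ge0 // ltW.
  have d16 : 0 <= 16 * d by rewrite mulr_ge0 // ltW.
  rewrite (EFinD ((1 + d) * _)) (EFinM (1 + d)) !(EFinM (16 * d)).
  rewrite (nrm_sqr_partition u pF).
  rewrite (nrm_sqr_partition f pF) (sqint_partition f mphi pF).
  rewrite -!nneseriesZl // => [|n _]; last exact: sqint_ge0.
  rewrite -!nneseriesD //; last 4 first.
  - by move=> n _ _; rewrite mule_ge0 // sqint_ge0.
  - by move=> n _ _; rewrite mule_ge0.
  - by move=> n _ _; rewrite mule_ge0.
  - by move=> n _ _; rewrite mule_ge0.
  split; apply: lee_nneseries => [n _ _|n _] //; rewrite -?EFinM -?EFinD.
  - exact: sqint_ge0.
  - by have [] := cell n.
  - by have [] := cell n.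
have [Ifin _] := bounds 1 ltr01 (lexx _).
have If : sqint phi f setT \is a fin_num.
  by rewrite ge0_fin_numE ?sqint_ge0 // (le_lt_trans Ifin) // ltry.
rewrite -(fineK If); congr EFin; apply/eqP; rewrite eq_le; apply/andP; split.
  apply: (@ler_addsmall _ _ _ (nrm u ^+ 2 + 16 * nrm f ^+ 2)) => d d0 d1.
  have [] := bounds d d0 d1; rewrite -(fineK If) lee_fin => + _.
  by move=> /le_trans; apply; lra.
apply: (@ler_addsmall _ _ _ (fine (sqint phi f setT) + 16 * nrm f ^+ 2)) => d d0 d1.
have [_] := bounds d d0 d1; rewrite -(fineK If) -EFinM -EFinD lee_fin /=.
by move=> /le_trans; apply; lra.
Qed.

End spectral_integrals.

(** * Existence of [phi(A) f] for square-integrable [phi] *)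

Section orthogonal_series.
Context {R : realType} {H : hilbertType R}.
Implicit Types (v : nat -> H).

Lemma pythagoras v m n : (forall k l, k <> l -> ip (v k) (v l) = 0) ->
  nrm (\sum_(m <= k < n) v k) ^+ 2 = \sum_(m <= k < n) nrm (v k) ^+ 2.
Proof.
move=> ov; have [mn|/ltnW/eqP nm] := leqP m n; last first.
  by rewrite /index_iota nm !big_nil nrm0 expr0n.
rewrite -(subnKC mn); elim: (n - m)%N => [|i IH].
  by rewrite addn0 /index_iota subnn !big_nil nrm0 expr0n.
rewrite addnS !big_nat_recr ?leq_addr //= nrmD_sqr IH.
suff -> : ip (\sum_(m <= k < m + i) v k) (v (m + i)%N) = 0 by rewrite mulr0 addr0.
rewrite big_nat; elim/big_ind: _ => [|x y x0 y0|k /andP[_ kmi]].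
- by rewrite ip0l.
- by rewrite ipDl x0 y0 addr0.
- by apply: ov => kE; rewrite kE ltnn in kmi.
Qed.

Lemma orthogonal_series_cvg v (K : R) :
  (forall k l, k <> l -> ip (v k) (v l) = 0) ->
  (forall n, \sum_(0 <= k < n) nrm (v k) ^+ 2 <= K) ->
  exists u : H, (fun n => \sum_(0 <= k < n) v k) @ \oo --> u.
Proof.
move=> ov hK; pose s n := \sum_(0 <= k < n) nrm (v k) ^+ 2.
have s_nd : {homo s : n m / (n <= m)%N >-> n <= m}.
  move=> n m nm; rewrite /s (big_cat_nat (leq0n n) nm) //= lerDl.
  by apply: sumr_ge0 => k _; exact: sqr_ge0.
have : cvgn s by apply: nondecreasing_is_cvgn => //; exists K => _ [n _ <-]; exact: hK.
move=> /cvg_ex[l sl]; apply: cauchy_nrm_cvg => e e0.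
have e2 : 0 < e ^+ 2 / 2 by rewrite divr_gt0 // exprn_gt0.
move/cvgrPdist_lt: sl => /(_ _ e2)[N _ HN]; exists N => n m Nn nm.
rewrite -(@ltr_pXn2r _ 2) ?nnegrE ?nrm_ge0 ?(ltW e0) //.
rewrite (big_cat_nat (leq0n n) nm) //= addrAC subrr add0r pythagoras //.
have -> : \sum_(n <= k < m) nrm (v k) ^+ 2 = s m - s n.
  by rewrite /s (big_cat_nat (leq0n n) nm) //= addrAC subrr add0r.
have := HN n Nn; have := HN m (leq_trans Nn nm); rewrite /= !ltr_norml.
by move=> /andP[? ?] /andP[? ?]; lra.
Qed.

End orthogonal_series.

Section existence.
Context {R : realType} {H : hilbertType R} {E : set (measurableTypeR R) -> H -> H}.
Hypothesis pE : projection_valued_measure E.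
Implicit Types (A B C : set (measurableTypeR R)) (f g u v : H).
Implicit Types (phi psi a b : measurableTypeR R -> R[i]).

Lemma pvm_cvg B (w : H^nat) u : measurable B -> w @ \oo --> u ->
  (fun n => E B (w n)) @ \oo --> E B u.
Proof.
move=> mB /cvg_nrmP h; apply/cvg_nrmP => e /h [N HN]; exists N => n /HN.
by apply: le_lt_trans; rewrite -(pvmB pE) // nrm_pvm_le.
Qed.

Definition approx phi (d : R) f u := forall B (c : R[i]) (e : R), measurable B ->
  0 <= e -> (forall t, B t -> cabs (phi t - c) <= e) ->
  nrm (E B (u - c *: f)) <= (e + d) * nrm (E B f).

(* The approximation is the orthogonal series of [c n *: E (F n) f], for a
   countable partition [F] into sets on which [phi] is within [d] of [c n]. *)
Lemma approx_exists phi f d : borel phi -> (sqint pE phi f setT < +oo)%E ->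
  0 < d -> d <= 1 -> exists u, approx phi d f u.
Proof.
move=> mphi fin d0 d1.
have [F pF sF] := borel_partition mphi d0; have [mF tF cF] := pF.
pose c n := if pselect (exists t, F n t) is left h then phi (projT1 (cid h)) else 0.
have cP n t : F n t -> cabs (phi t - c n) <= d.
  move=> Fnt; rewrite /c; case: pselect => [h|]; last by case; exists t.
  by apply: (sF n) => //; exact: projT2 (cid h).
pose v n := c n *: E (F n) f.
have ov k l : k <> l -> ip (v k) (v l) = 0.
  move=> kl; rewrite /v ipZl ipZr (pvm_sym pE) // (pvm_disj pE) ?ip0r ?mulr0 //.
  by apply/eqP/negPn/negP => /set0P/(tF k l I I)/kl.
(* On the cell [m <= |phi|], while [|c n| <= m + 1] because [d <= 1]; so [|c n|^2 <= 2 m^2 + 2], and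
   the resulting bounds are summable by the finiteness of the integral. *)
have bv n : ((nrm (v n) ^+ 2)%:E <= 2%:E * sqint pE phi f (F n) +
    (2 * nrm (E (F n) f) ^+ 2)%:E)%E.
  pose m := Num.max 0 (cabs (c n) - d).
  have m0 : 0 <= m by rewrite le_max lexx.
  have mt t : F n t -> m <= cabs (phi t).
    move=> Fnt; rewrite ge_max cabs_ge0 lerBlDl /=.
    by rewrite (le_trans (ler_cabs_sub _ (phi t))) // lerD2r cabsBC cP.
  have := sqint_ge_cst pE f mphi (mF n) m0 mt => hm.
  have : (2%:E * (m ^+ 2 * nrm (E (F n) f) ^+ 2)%:E <= 2%:E * sqint pE phi f (F n))%E.
    by apply: lee_wpmul2l => //; rewrite lee_fin.
  move=> /(leeD2r (2 * nrm (E (F n) f) ^+ 2)%:E); apply: le_trans.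
  rewrite -EFinM -EFinD lee_fin /v nrmZ exprMn.
  have cm : cabs (c n) <= m + 1.
    by rewrite -lerBlDr (le_trans _ (_ : cabs (c n) - d <= _)) ?lerB // le_max lexx orbT.
  have c2 : cabs (c n) ^+ 2 <= 2 * m ^+ 2 + 2.
    have : cabs (c n) ^+ 2 <= (m + 1) ^+ 2.
      by rewrite ler_pXn2r ?nnegrE ?cabs_ge0 ?addr_ge0.
    by move=> /le_trans; apply; have := sqr_ge0 (m - 1); nra.
  have := ler_wpM2r (sqr_ge0 (nrm (E (F n) f))) c2; lra.
have sv n : \sum_(0 <= k < n) nrm (v k) ^+ 2 <=
    2 * fine (sqint pE phi f setT) + 2 * nrm f ^+ 2.
  rewrite -lee_fin EFinD !(EFinM 2) fineK ?ge0_fin_numE ?sqint_ge0 //.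
  rewrite (sqint_partition pE f mphi pF) (nrm_sqr_partition pE f pF).
  rewrite -!nneseriesZl => [|k _|k _]; last 2 first.
  - by rewrite lee_fin sqr_ge0.
  - exact: sqint_ge0.
  rewrite -nneseriesD; last 2 first.
  - by move=> k _ _; rewrite mule_ge0 ?lee_fin // sqint_ge0.
  - by move=> k _ _; rewrite mule_ge0 ?lee_fin // sqr_ge0.
  rewrite -sumEFin; apply: (@le_trans _ _
    (\sum_(0 <= k <oo) (nrm (v k) ^+ 2)%:E)%E).
    by apply: nneseries_lim_ge => k _ _; rewrite lee_fin sqr_ge0.
  by apply: lee_nneseries => [k _ _|k _] //; rewrite ?lee_fin ?sqr_ge0 // -EFinM bv.
have [u su] := orthogonal_series_cvg ov sv.
have EFu k : E (F k) u = v k.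
  apply: (cvg_unique (@norm_hausdorff _ _) (pvm_cvg (mF k) su)).
  apply: cvg_near_cst; exists k.+1 => // n /= kn.
  elim: n kn => // n IH; rewrite ltnS leq_eqVlt => /orP[/eqP <-|kn].
    rewrite big_nat_recr //= (pvmD pE) // /v (pvmZ pE) // (pvm_idem pE) //.
    rewrite big_nat (_ : E _ _ = 0) ?add0r //.
    elim/big_ind: _ => [|x y x0 y0|i /andP[_ ik]].
    - exact: pvm0r.
    - by rewrite (pvmD pE) // x0 y0 addr0.
    - rewrite (pvmZ pE) // (pvm_disj pE) ?scaler0 //.
      apply/eqP/negPn/negP => /set0P/(tF k i I I) ki.
      by rewrite ki ltnn in ik.
  rewrite big_nat_recr //= (pvmD pE) // IH // /v (pvmZ pE) // (pvm_disj pE) //.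
    by rewrite scaler0 addr0.
  apply/eqP/negPn/negP => /set0P/(tF k n I I) ki.
  by rewrite ki ltnn in kn.
exists u => B c' e mB e0 h.
have ed0 : 0 <= e + d by rewrite addr_ge0 // ltW.
rewrite -(@ler_pXn2r _ 2) ?nnegrE ?mulr_ge0 ?nrm_ge0 // exprMn.
pose m g C := nrm (E C g) ^+ 2.
have sm g : sigma_sum (m g) by exact: sigma_sum_pvm.
pose m2 C := (e + d) ^+ 2 * m f C.
have sm2 : sigma_sum m2 by exact: sigma_sumZ.
change (m (u - c' *: f) B <= m2 B).
apply: (le_over_partition (sm _) sm2 pF mB) => n; rewrite /m2 /m.
have mBF : measurable (B `&` F n) by exact: measurableI.
have -> : E (B `&` F n) (u - c' *: f) = (c n - c') *: E (B `&` F n) f.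
  rewrite (pvmB pE) // (pvmZ pE) // -(pvmI pE) // EFu /v (pvmZ pE) //.
  by rewrite (pvmI pE) // scalerBl.
have [[t [Bt Ft]]|/set0P/negP/negPn/eqP ->] := pselect (B `&` F n !=set0); last first.
  by rewrite !pvm_set0 // scaler0 nrm0 expr0n mulr0.
rewrite nrmZ exprMn ler_wpM2r ?sqr_ge0 // ler_pXn2r ?nnegrE ?cabs_ge0 //.
have -> : c n - c' = - (phi t - c n) + (phi t - c') by rewrite opprB subrKA.
by rewrite (le_trans (cabsD _ _)) // cabsN addrC lerD ?h ?cP.
Qed.

(** On a cell of oscillation [d] both vectors are compared with the same multiple [phi t *: f]. The
    errors [2 d] and [d + d'] are rounded up to [3 (d + d')]. *)
Lemma approx_dist phi f d d' u u' : borel phi -> 0 < d -> 0 < d' ->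
  approx phi d f u -> approx phi d' f u' -> nrm (u - u') <= 3 * (d + d') * nrm f.
Proof.
move=> mphi d0 d'0 fu fu'.
have K0 : 0 <= 3 * (d + d') by rewrite mulr_ge0 // addr_ge0 // ltW.
rewrite -(@ler_pXn2r _ 2) ?nnegrE ?(mulr_ge0 K0) ?nrm_ge0 // exprMn.
pose m g C := nrm (E C g) ^+ 2.
have sm g : sigma_sum (m g) by exact: sigma_sum_pvm.
pose m2 C := (3 * (d + d')) ^+ 2 * m f C.
have sm2 : sigma_sum m2 by exact: sigma_sumZ.
suff : m (u - u') setT <= m2 setT by rewrite /m2 /m !(pvm_setT pE).
apply: (le_by_partition (sm _) sm2 mphi d0 measurableT) => B mB _ sB.
rewrite /m2 /m; have [[t Bt]|/set0P/negP/negPn/eqP ->] := pselect (B !=set0); last first.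
  by rewrite !pvm_set0 // nrm0 expr0n mulr0.
rewrite -exprMn ler_pXn2r ?nnegrE ?(mulr_ge0 K0) ?nrm_ge0 //.
have h1 := fu B (phi t) d mB (ltW d0) (fun s Bs => sB _ _ Bs Bt).
have h2 := fu' B (phi t) d mB (ltW d0) (fun s Bs => sB _ _ Bs Bt).
have -> : u - u' = (u - phi t *: f) - (u' - phi t *: f) by rewrite opprB subrKA.
rewrite (pvmB pE) // (le_trans (nrmD _ _)) // nrmN (le_trans (lerD h1 h2)) //.
have nB := nrm_ge0 (E B f); have := mulr_ge0 (ltW d'0) nB; nra.
Qed.

Lemma applies_exists phi f : borel phi -> (sqint pE phi f setT < +oo)%E ->
  exists u, applies E phi f u.
Proof.
move=> mphi fin; pose d n : R := n.+1%:R^-1.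
have d0 n : 0 < d n by rewrite invr_gt0.
have d1 n : d n <= 1 by rewrite invf_le1 // ler1n.
have /choice[w hw] n := approx_exists mphi fin (d0 n) (d1 n).
have small_d (e : R) : 0 < e -> exists N, forall n, (N <= n)%N -> d n < e.
  move=> e0; have /cvgrPdist_lt/(_ _ e0)[N _ HN] := @cvg_harmonic R.
  exists N => n /HN; rewrite /= sub0r normrN ger0_norm // invr_ge0 //.
(* The distance of two approximations is at most [3 (d m + d n) |f|], so slacks below
   [e / (6 (|f| + 1))] make it smaller than [e]. *)
have nf0 : 0 < 6 * (nrm f + 1) by rewrite mulr_gt0 // ltr_wpDl ?nrm_ge0.
have [u wu] : exists u : H, w @ \oo --> u.
  apply: cauchy_nrm_cvg => e e0.
  have [N HN] := small_d _ (divr_gt0 e0 nf0); exists N => n m Nn nm.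
  apply: le_lt_trans (approx_dist mphi (d0 m) (d0 n) (hw m) (hw n)) _.
  have := HN _ (leq_trans Nn nm); have := HN _ Nn; rewrite !ltr_pdivlMr //.
  have := nrm_ge0 f; have := d0 m; have := d0 n; nra.
exists u => B c e mB e0 h; apply/ler_addgt0Pr => eps eps0.
have e2 : 0 < eps / 2 by rewrite divr_gt0.
have [N1 HN1] := small_d _ (divr_gt0 e2 nf0).
have [N2 HN2] := (cvg_nrmP _ _).1 wu _ e2.
pose n := maxn N1 N2.
have h1 := HN1 n (leq_maxl _ _); have h2 := HN2 n (leq_maxr _ _).
have -> : u - c *: f = (u - w n) + (w n - c *: f) by rewrite subrKA.
rewrite (pvmD pE) // (le_trans (nrmD _ _)) //.
have h3 := hw n B c e mB e0 h.
have h4 : nrm (E B (u - w n)) <= nrm (w n - u) by rewrite nrmBC nrm_pvm_le.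
have h5 : nrm (E B f) <= nrm f by exact: nrm_pvm_le.
move: h1; rewrite ltr_pdivlMr // => h1.
have := nrm_ge0 (E B f); have := d0 n; have := nrm_ge0 f; nra.
Qed.

End existence.

(** * Agreement of [applies] with the weakly defined spectral integral *)

Section integral_on_measurable_sets.
Import HBNNSimple.

(** The integral is built from simple functions, whose level sets are measurable, so values of the
    set function elsewhere never enter. This permits replacing [spectral_mu] by the measure
    [specm]. *)
Lemma eq_integral_measurable d (T : measurableType d) (R : realType)
    (m1 m2 : set T -> \bar R) (g : T -> \bar R) :
  (forall B, measurable B -> m1 B = m2 B) ->
  (\int[m1]_t g t = \int[m2]_t g t)%E.
Proof.
move=> m12; rewrite /integral; congr (_ - _)%E; congr ereal_sup;
  apply: eq_imagel => h _; apply: eq_fsbigr => x _;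
  by rewrite m12 //; exact: (measurable_funPTI h).
Qed.

End integral_on_measurable_sets.

Section spectral_integral_applies.
Context {R : realType} {H : hilbertType R} {E : set (measurableTypeR R) -> H -> H}.
Hypothesis pE : projection_valued_measure E.
Implicit Types (A B C : set (measurableTypeR R)) (f g u v : H).
Implicit Types (phi : measurableTypeR R -> R).

Lemma integral_spectral_mu f (g : measurableTypeR R -> \bar R) :
  (\int[spectral_mu E f]_t g t = \int[specm pE f]_t g t)%E.
Proof.
apply: eq_integral_measurable => B mB.
by rewrite /spectral_mu (pvm_ip pE).
Qed.

Lemma spectral_domP phi f : measurable_fun setT phi ->
  spectral_dom E phi f <-> (sqint pE (fun t => (phi t)%:C) f setT < +oo)%E.
Proof.
move=> mphi; rewrite /spectral_dom /= integrable.unlock.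
have -> : (\int[spectral_mu E f]_t `|(phi t ^+ 2)%:E|)%E =
    sqint pE (fun t => (phi t)%:C) f setT.
  rewrite integral_spectral_mu /sqint; apply: eq_integral => t _.
  by rewrite gee0_abs ?lee_fin ?sqr_ge0 // cabsR real_normK // num_real.
split=> [/asboolP[]|h] //; apply/asboolP; split => //.
by apply/measurable_EFinP; exact: measurable_funX.
Qed.

Lemma applies_dom phi f u : measurable_fun setT phi ->
  applies E (fun t => (phi t)%:C) f u -> spectral_dom E phi f.
Proof.
move=> mphi fu; apply/spectral_domP => //.
by rewrite (sqint_applies pE (borel_real mphi) fu) ltry.
Qed.

Lemma spectral_dom_applies phi f : measurable_fun setT phi ->
  spectral_dom E phi f -> exists u, applies E (fun t => (phi t)%:C) f u.
Proof.
move=> mphi /(spectral_domP _ mphi); apply: applies_exists.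
exact: borel_real.
Qed.

Lemma sqint_shift phi (c : R[i]) f u : measurable_fun setT phi ->
  applies E (fun t => (phi t)%:C) f u ->
  sqint pE (fun t => (phi t)%:C + c) f setT = (nrm (u + c *: f) ^+ 2)%:E.
Proof.
move=> mphi fu; apply: sqint_applies.
- by apply: borelD; [exact: borel_real|exact: borel_cst].
- exact: applies_shift.
Qed.

(** For real [phi] the functions [phi + i] and [phi - i] have the same modulus, so [u + i f] and
    [u - i f] have the same norm; the difference of the squares is a multiple of the imaginary part
    in question. *)
Lemma applies_ip_real phi f u : measurable_fun setT phi ->
  applies E (fun t => (phi t)%:C) f u -> complex.Im (ip u f) = 0.
Proof.
move=> mphi fu.
have : nrm (u + 'i%C *: f) ^+ 2 = nrm (u + (- 'i%C) *: f) ^+ 2.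
  apply: EFin_inj; rewrite -!(sqint_shift _ mphi fu) /sqint.
  apply: eq_integral => t _; rewrite !cabs_sqr /=.
  by rewrite !addr0 !add0r oppr0 !addr0 sqrrN.
rewrite !nrmD_sqr !nrmZ cabsN => h.
have {h} : complex.Re (ip u ('i%C *: f)) = complex.Re (ip u (- 'i%C *: f)) by lra.
rewrite !ipZr; case: (ip u f) => a b /= ; lra.
Qed.

Lemma applies_ip_integral phi f u : measurable_fun setT phi ->
  applies E (fun t => (phi t)%:C) f u ->
  fine (\int[spectral_mu E f]_t (phi t)%:E)%E = complex.Re (ip u f).
Proof.
move=> mphi fu; rewrite integral_spectral_mu.
pose sq c t := (phi t + c) ^+ 2.
have msq c : measurable_fun setT (sq c).
  by apply: measurable_funX; apply: measurable_funD => //; exact: measurable_cst.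
have sqE c : (\int[specm pE f]_t (sq c t)%:E)%E = (nrm (u + c%:C *: f) ^+ 2)%:E.
  rewrite -(sqint_shift _ mphi fu) /sqint; apply: eq_integral => t _.
  by rewrite /sq -rmorphD /= cabsR real_normK // num_real.
have isq c : (specm pE f).-integrable setT (EFin \o sq c).
  apply/integrableP; split; first exact/measurable_EFinP.
  rewrite (_ : (\int[_]_(_ in _) _)%E = (nrm (u + c%:C *: f) ^+ 2)%:E) ?ltry //.
  by rewrite -sqE; apply: eq_integral => t _; rewrite /= ger0_norm // /sq sqr_ge0.
(* [4 phi = (phi + 1)^2 - (phi - 1)^2] *)
have -> : (\int[specm pE f]_t (phi t)%:E =
    4^-1%:E * \int[specm pE f]_t ((sq 1 t)%:E - (sq (-1) t)%:E))%E.
  rewrite -integralZl //; last exact: (integrableB measurableT (isq 1) (isq (-1))).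
  apply: eq_integral => t _; rewrite -EFinB -EFinM; congr EFin.
  by rewrite /sq; field.
rewrite integralB_EFin // !sqE -EFinB -EFinM /= !nrmD_sqr !nrmZ !ipZr !cabsR.
by rewrite !conjR !ReM /= !mul0r !subr0 normrN1 normr1; field.
Qed.

(** Polarization of [applies_ip_real]: the form is real at [c f + g], and [c = 1] and [c = i] yield
    both parts of the identity. *)
Lemma applies_ip_sym phi f g u v : measurable_fun setT phi ->
  applies E (fun t => (phi t)%:C) f u -> applies E (fun t => (phi t)%:C) g v ->
  ip u g = ip f v.
Proof.
move=> mphi fu gv; have mC := borel_real mphi.
have key c : complex.Im (c * (ip u g - ip f v)) = 0.
  have := applies_ip_real mphi (applies_lin pE c mC fu gv).
  rewrite ipDl !ipDr !ipZl !ipZr !ImD (applies_ip_real mphi gv) addr0.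
  have -> : complex.Im (c * (c^* * ip u f)) = 0.
    rewrite mulrA mul_conj ImM (applies_ip_real mphi fu).
    by rewrite mulr0 mul0r addr0.
  rewrite add0r (ip_conj v f) -rmorphM /= ImC => h.
  by rewrite mulrBr ImD ImN.
apply/eqP; rewrite -subr_eq0 eq_complex; move: (key 1) (key 'i%C).
rewrite !ImM /= !mul0r !mul1r !(addr0, add0r) => -> ->.
by rewrite eqxx.
Qed.

Lemma spectral_formE phi f g u v : measurable_fun setT phi ->
  applies E (fun t => (phi t)%:C) f u -> applies E (fun t => (phi t)%:C) g v ->
  spectral_form E phi f g = ip u g.
Proof.
move=> mphi fu gv; have mC := borel_real mphi.
(* With [c = i^k] the first two terms do not depend on [k] and cancel against the sum of the powers
   of [i]; only the cross term survives the sum in [spectral_form]. *)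
have intE c : fine (\int[spectral_mu E (f + c *: g)%R]_t (phi t)%:E)%E =
    complex.Re (ip u f) + cabs c ^+ 2 * complex.Re (ip v g) +
    2 * complex.Re (c^* * ip u g).
  rewrite addrC (applies_ip_integral mphi (applies_lin pE c mC gv fu)).
  rewrite ipDl !ipDr !ipZl !ipZr (ip_conj v f) -(applies_ip_sym mphi fu gv).
  rewrite mulrA mul_conj -(conjCK c) -rmorphM /= conjCK !ReD ReC.
  rewrite !ReM /= mul0r subr0; ring.
rewrite /spectral_form !big_ord_recl big_ord0 !intE.
have i2 : 'i%C ^+ 2 = -1 :> R[i] by exact: sqr_i.
have i3 : 'i%C ^+ 3 = - 'i%C :> R[i] by rewrite exprS i2 mulrN1.
rewrite /= -[bump 0 (bump 0 (bump 0 0))]/3%N -[bump 0 (bump 0 0)]/2%N.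
rewrite -[bump 0 0]/1%N expr0 expr1 i2 i3 !cabs_sqr.
move: (complex.Re (ip u f)) (complex.Re (ip v g)) (ip u g) => p q [a b].
have -> : 4^-1 = (4^-1)%:C :> R[i] by rewrite fmorphV /= rmorph_nat.
have sumE (r0 r1 r2 r3 : R) : (4^-1)%:C * (1 * r0%:C + ('i%C * r1%:C +
    (-1 * r2%:C + (- 'i%C * r3%:C + 0)))) =
    (4^-1 * (r0 - r2)) +i* (4^-1 * (r1 - r3)).
  apply/eqP; rewrite eq_complex !(ReM, ImM, ReD, ImD, ReN, ImN) /=.
  by apply/andP; split; apply/eqP; ring.
rewrite sumE; apply/eqP; rewrite eq_complex !(ReM, ReC, ImC, ReN, ImN) /=.
by apply/andP; split; apply/eqP; field.
Qed.

(** On a cell [B] of oscillation at most 1 the function [phi] is bounded, so [E B x] lies in the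
    domain and [|E B x|^2 = (x, E B x) = 0]. The zero set function [z] lets the localization
    principle sum this up. *)
Lemma dense_spectral_dom phi x : measurable_fun setT phi ->
  (forall g, spectral_dom E phi g -> ip x g = 0) -> x = 0.
Proof.
move=> mphi h; have mC := borel_real mphi.
apply: nrm_eq0; apply/eqP; rewrite -sqrf_eq0 eq_le sqr_ge0 andbT.
rewrite -(pvm_setT pE x).
pose z (B : set (measurableTypeR R)) : R := 0.
have sz : sigma_sum z.
  by move=> F _ _; rewrite /z; under eq_fun do rewrite big1 //; exact: cvg_cst.
change (z setT >= nrm (E setT x) ^+ 2).
apply: (le_by_partition (@sigma_sum_pvm _ _ _ pE x) sz mC ltr01 measurableT).
move=> B mB _ sB; rewrite /z nrm_sqr -(pvm_sym pE) // (pvm_idem pE) //.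
have [[t Bt]|/set0P/negP/negPn/eqP ->] := pselect (B !=set0); last first.
  by rewrite pvm_set0 // ip0l.
rewrite (pvm_sym pE) // h //.
pose b s := (phi s)%:C * (\1_B s)%:C.
have mb : borel b by apply: borelM => //; exact: borel_indic.
have bb s : cabs (b s) <= cabs (phi t)%:C + 1.
  rewrite /b cabsM !cabsR indicE; case: (boolP (s \in B)) => [/set_mem Bs|_].
    rewrite normr1 mulr1 -!cabsR (le_trans (ler_cabs_sub _ (phi t)%:C)) //.
    by rewrite addrC lerD2l sB.
  by rewrite normr0 mulr0 addr_ge0.
have [v bv] : exists v, applies E b x v.
  apply: (@applies_exists _ _ _ pE b x mb); apply: le_lt_trans (ltry _).
  exact: (sqint_le_cst pE x mb measurableT (fun s _ => bb s)).
apply: (@applies_dom _ _ v) => //.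
exact: (applies_comp pE (borel_indic mB) mC (applies_indic pE x mB) bv).
Qed.

(** The bridge from the given functional calculus to [applies]: a vector produced by the existence
    result satisfies the same weak identity, and density of the domain makes it equal to [p.2]. *)
Lemma spectral_integralP phi p : measurable_fun setT phi ->
  spectral_integral E phi p <-> applies E (fun t => (phi t)%:C) p.1 p.2.
Proof.
move=> mphi; split=> [[dp hp]|pp].
  have [u pu] := spectral_dom_applies mphi dp.
  suff /eqP : p.2 - u = 0 by rewrite subr_eq0 => /eqP ->.
  apply: (dense_spectral_dom mphi) => g dg.
  have [v gv] := spectral_dom_applies mphi dg.
  by rewrite ipBl hp // (spectral_formE mphi pu gv) subrr.
split; first exact: applies_dom pp.
move=> g dg; have [v gv] := spectral_dom_applies mphi dg.
by rewrite (spectral_formE mphi pp gv).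
Qed.

End spectral_integral_applies.

(** * Resolvent set and null sets *)

Section resolvent.
Context {R : realType} {H : hilbertType R} {E : set (measurableTypeR R) -> H -> H}.
Hypothesis pE : projection_valued_measure E.
Implicit Types (A B C N : set (measurableTypeR R)) (f g u v w : H) (lam : R[i]).

Lemma applies_bounded_exists (b : measurableTypeR R -> R[i]) (s : R) f :
  borel b -> (forall t, cabs (b t) <= s) -> exists u, applies E b f u.
Proof.
move=> mb hs; apply: (@applies_exists _ _ _ pE b f mb); apply: le_lt_trans (ltry _).
exact: (sqint_le_cst pE f mb measurableT (fun t _ => hs t)).
Qed.

Lemma borel_id : borel (fun t : measurableTypeR R => t%:C).
Proof. by apply: borel_real; exact: measurable_id. Qed.

Lemma borel_sub lam : borel (fun t : measurableTypeR R => t%:C - lam).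
Proof. by apply: borelD; [exact: borel_id|exact: borel_cst]. Qed.

(** The trace on the real line of an open disc about a complex point, so that real and non-real
    [lam] are handled alike. *)
Definition disc lam (d : R) : set (measurableTypeR R) :=
  [set t : R | cabs (t%:C - lam) < d].

Lemma measurable_disc lam d : measurable (disc lam d).
Proof.
rewrite (_ : disc lam d =
  setT `&` (fun t : measurableTypeR R => cabs (t%:C - lam)) @^-1` `]-oo, d[%classic).
  by apply: (measurable_cabs (borel_sub lam)) => //; exact: measurable_itv.
by apply/seteqP; split=> t /=; rewrite in_itv /=; [move=> ?; split|case].
Qed.

Definition null B := forall g, E B g = 0.

Lemma null_sub A B : measurable A -> measurable B -> A `<=` B -> null B -> null A.
Proof. by move=> mA mB AB nB g; exact: (pvm_null_sub pE mA mB AB (nB g)). Qed.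

Lemma null_bigcup (F : nat -> set (measurableTypeR R)) :
  (forall n, measurable (F n)) -> (forall n, null (F n)) -> null (\bigcup_n F n).
Proof.
move=> mF nF g; apply: nrm_eq0; apply/eqP; rewrite -sqrf_eq0 -eqe.
rewrite -[X in X == _]/(specm pE g (\bigcup_n F n)).
apply/eqP/measure_negligible; first exact: bigcup_measurable.
apply: negligible_bigcup => n; apply/negligibleP; first exact: mF.
change (specm pE g (F n) = 0%E).
by rewrite /specm nF nrm0 expr0n.
Qed.

Context {A0 : set (H * H)}.
Hypothesis A0P : forall p, A0 p <-> applies E (fun t => t%:C) p.1 p.2.

(** On the range of [E (disc lam d)] the operator [A0 - lam] has norm at most [d], so a nonzero
    vector [x] there would satisfy [|x| <= |c| d |x| < |x|] for [d = 1 / (|c| + 1)]. The hypothesis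
    is a lower bound alone because this is what semiboundedness supplies in
    [bounded_below_spectrum]. *)
Lemma bounded_below_null_disc lam (c : R) :
  (forall p, A0 p -> nrm p.1 <= c * nrm (p.2 - lam *: p.1)) ->
  exists2 d, 0 < d & null (disc lam d).
Proof.
move=> hc; have c1 : 0 < `|c| + 1 by rewrite ltr_wpDl.
pose d := (`|c| + 1)^-1; have d0 : 0 < d by rewrite invr_gt0.
exists d => // x; have mB := measurable_disc lam d; set B := disc lam d.
pose b (t : measurableTypeR R) : R[i] := t%:C * (\1_B t)%:C.
have mb : borel b by apply: borelM; [exact: borel_id|exact: borel_indic].
have bb t : cabs (b t) <= d + cabs lam.
  rewrite /b cabsM (cabsR (\1_B t)) indicE; case: (boolP (t \in B)) => [/set_mem Bt|_].
    by rewrite normr1 mulr1 (le_trans (ler_cabs_sub _ lam)) // lerD2r ltW.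
  by rewrite normr0 mulr0 addr_ge0 ?cabs_ge0 // ltW.
have [v bv] := applies_bounded_exists x mb bb.
have gv := applies_comp pE (borel_indic mB) borel_id (applies_indic pE x mB) bv.
have Bv : E B v = v.
  apply: (applies_supp pE mB bv) => t Bt.
  by rewrite /b indicE memNset // mulr0.
have := gv B lam d mB (ltW d0) (fun t Bt => ltW Bt).
rewrite (pvmB pE) // (pvmZ pE) // Bv !(pvm_idem pE) // => h1.
have := hc (E B x, v) ((A0P (E B x, v)).2 gv) => /= h2.
apply: nrm_eq0; apply/eqP; rewrite eq_le nrm_ge0 andbT.
have n0 := nrm_ge0 (E B x).
have h3 : nrm (E B x) <= `|c| * (d * nrm (E B x)).
  apply: le_trans h2 _; apply: le_trans (ler_wpM2r (nrm_ge0 _) (ler_norm c)) _.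
  by rewrite ler_wpM2l.
have h4 : nrm (E B x) = (`|c| + 1) * (d * nrm (E B x)).
  by rewrite mulrA divff ?mul1r // gt_eqF.
have : d * nrm (E B x) <= 0.
  by move: h3; rewrite {1}h4 mulrDl mul1r gerDl.
by rewrite pmulr_rle0.
Qed.

Lemma resolvent_null_disc lam : resolvent_set A0 lam ->
  exists2 d, 0 < d & null (disc lam d).
Proof. by move=> [_ [c hc]]; exact: bounded_below_null_disc hc. Qed.

(** The inverse is the function [k], set to 0 on the disc where [t - lam] may be small. It is
    bounded by [1 / d], and its product with [t - lam] is 1 off a null set. *)
Lemma null_disc_resolvent lam d : 0 < d -> null (disc lam d) -> resolvent_set A0 lam.
Proof.
move=> d0 nB; have mB := measurable_disc lam d.
pose Bc := ~` disc lam d.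
have mBc : measurable Bc by exact: measurableC.
pose k (t : measurableTypeR R) : R[i] := (t%:C - lam)^-1 * (\1_Bc t)%:C.
have mk : borel k.
  by apply: borelM; [apply: borelV; exact: borel_sub|exact: borel_indic].
have BcP t : Bc t -> d <= cabs (t%:C - lam) by move=> /negP; rewrite -leNgt.
have Bc0 t : Bc t -> t%:C - lam != 0.
  move=> /BcP dt; apply/eqP => t0; move: dt; rewrite t0 cabs0 leNgt.
  by rewrite d0.
have kb t : cabs (k t) <= d^-1.
  rewrite /k cabsM (cabsR (\1_Bc t)) indicE; case: (boolP (t \in Bc)) => [/set_mem Bt|_].
    rewrite normr1 mulr1 cabsV lef_pV2 ?posrE ?BcP //.
    by rewrite (lt_le_trans d0) ?BcP.
  by rewrite normr0 mulr0 invr_ge0 ltW.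
have kE (t : measurableTypeR R) : ~ disc lam d t -> (t%:C - lam) * k t = 1.
  by move=> Bt; rewrite /k indicE mem_set // mulr1 mulfV // Bc0.
have one f : applies E (fun=> 1) f f by have := @applies_cst _ _ _ pE 1 f; rewrite scale1r.
have inv_bound p : A0 p -> nrm p.1 <= d^-1 * nrm (p.2 - lam *: p.1).
  move=> /A0P fu; have := applies_shift (- lam) fu; rewrite scaleNr => fw.
  have : applies E k (p.2 - lam *: p.1) p.1.
    apply: (applies_comp pE (borel_sub lam) mk fw).
    apply: (applies_ae pE mB nB _ (one p.1)) => t Bt.
    by rewrite mulrC kE.
  by move=> /(applies_le pE); apply.
split; last by exists d^-1.
move=> w; have [f wf] := applies_bounded_exists w mk kb.
have fw : applies E (fun t => t%:C - lam) f w.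
  apply: (applies_comp pE mk (borel_sub lam) wf).
  by apply: (applies_ae pE mB nB _ (one w)) => t Bt; rewrite kE.
have A0f : A0 (f, w + lam *: f).
  apply/A0P; have := applies_shift lam fw; congr (applies E _ _ _).
  by apply/funext => t; rewrite subrK.
exists f; split => // f' /A0P f'w.
have := applies_lin pE (- 1) borel_id f'w ((A0P _).1 A0f) => /= fs.
have := inv_bound (_, _) ((A0P (_, _)).2 fs) => /=.
have -> : -1 *: (w + lam *: f') + (w + lam *: f) - lam *: (-1 *: f' + f) = 0.
  by rewrite !scaleN1r opprD addrACA addNr add0r scalerDr scalerN subrr.
rewrite nrm0 mulr0 => h.
have /eqP : -1 *: f' + f = 0 by apply: nrm_eq0; apply/eqP; rewrite eq_le h nrm_ge0.
by rewrite scaleN1r addrC subr_eq0 => /eqP.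
Qed.

Lemma null_disc_nonreal lam : null (disc lam `|complex.Im lam|).
Proof.
have -> : disc lam `|complex.Im lam| = set0; last by move=> g; exact: pvm_set0.
apply/seteqP; split=> t //=; apply/negP; rewrite -leNgt.
by have := normr_Im_le (t%:C - lam); rewrite ImD ImN /= sub0r normrN.
Qed.

Lemma resolvent_nonreal lam : complex.Im lam != 0 -> resolvent_set A0 lam.
Proof.
move=> l0; apply: (@null_disc_resolvent _ `|complex.Im lam|).
  by rewrite normr_gt0.
exact: null_disc_nonreal.
Qed.

Lemma null_disc_nbhs lam lam' d : null (disc lam d) -> cabs (lam' - lam) <= d / 2 ->
  null (disc lam' (d / 2)).
Proof.
move=> nd ll; apply: null_sub nd; try exact: measurable_disc.
rewrite /disc => t /= td.
have -> : t%:C - lam = (t%:C - lam') + (lam' - lam) by rewrite subrKA.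
by rewrite (le_lt_trans (cabsD _ _)) // [d]splitr ltr_leD.
Qed.

(** Each real resolvent point has a null disc, but an uncountable union of null sets need not be
    null. Countably many discs with rational centres and radii [1 / (n + 1)] suffice; those that are
    not null are replaced by the empty set. *)
Lemma null_real_resolvent : exists N,
  [/\ measurable N, null N & forall t : R, resolvent_set A0 t%:C -> N t].
Proof.
pose D (qn : rat * nat) := disc (ratr qn.1)%:C qn.2.+1%:R^-1.
pose F k := if unpickle k is Some qn then
  if `[< null (D qn) >] then D qn else set0 else set0 : set (measurableTypeR R).
have mF k : measurable (F k).
  rewrite /F; case: unpickle => [qn|]; last exact: measurable0.
  by case: ifP => _; [exact: measurable_disc|exact: measurable0].
have n0 : null set0 by move=> g; exact: pvm_set0.
have nF k : null (F k).
  rewrite /F; case: unpickle => [qn|] //.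
  by case: ifP => // /asboolP.
exists (\bigcup_k F k); split.
- exact: bigcup_measurable.
- exact: null_bigcup.
move=> t /resolvent_null_disc [d d0 nd].
have d2 : 0 < d / 2 by rewrite divr_gt0.
(* A radius below [d / 2] ensures that a disc with rational centre containing [t] stays inside
   [disc t d], and hence is null. *)
have /cvgrPdist_lt/(_ _ d2)[n _ Hn] := @cvg_harmonic R.
have := Hn n (leqnn n); rewrite /= sub0r normrN ger0_norm ?invr_ge0 // => nd2.
have n1 : 0 < n.+1%:R^-1 :> R by rewrite invr_gt0.
have nn : t - n.+1%:R^-1 < t + n.+1%:R^-1 by rewrite ltrBlDr -addrA ltrDl addr_gt0.
have [q] := rat_in_itvoo nn; rewrite in_itv /= => /andP[q1 q2].
have tq : `|t - ratr q| < n.+1%:R^-1 by rewrite ltr_distlC q1 q2.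
have nD : null (D (q, n)).
  apply: null_sub nd; try exact: measurable_disc.
  move=> s; rewrite /D /disc /= => sq.
  have -> : s%:C - t%:C = (s%:C - (ratr q)%:C) - (t%:C - (ratr q)%:C).
    by rewrite opprB subrKA.
  apply: le_lt_trans (cabsD _ _) _; rewrite cabsN -(rmorphB _ t) /= cabsR.
  by rewrite [d]splitr ltrD // (lt_trans _ nd2).
have FE qn : null (D qn) -> F (pickle qn) = D qn.
  by move=> nqn; rewrite /F pickleK asboolT.
have tD : D (q, n) t by rewrite /D /disc /= -rmorphB /= cabsR.
by move: (pickle _) (FE _ nD) => k FkE; exists k => //; rewrite FkE.
Qed.

End resolvent.

(** * The bound for the Weyl function *)

Section weyl_function.
Context {R : realType} {H G : hilbertType R}.
Context {S T : linop H H} {Gamma0 Gamma1 : linop H G}.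
Hypothesis hPi : quasi_boundary_triple S T Gamma0 Gamma1.
Let A0 := A0_of T Gamma0.
Context {E : set (measurableTypeR R) -> H -> H}.
Hypothesis pE : projection_valued_measure E.
Hypothesis A0P : forall p, A0 p <-> applies E (fun t => t%:C) p.1 p.2.
Context {mu : R[i]} {alpha : R} {P : set (H * H)}.
Let psi (t : measurableTypeR R) : R := cabs (t%:C - mu) `^ alpha.
Let phi (t : measurableTypeR R) : R := cabs (t%:C - mu) `^ (- alpha).
Hypothesis PP : forall p, P p <->
  applies E (fun t => (cabs (t%:C - mu) `^ (- alpha))%:C) p.1 p.2.
Context {c : R}.
Hypothesis c0 : 0 <= c.
Hypothesis hc : forall p, rel_comp (graph Gamma1) P p -> nrm p.2 <= c * nrm p.1.
Context {N : set (measurableTypeR R)}.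
Hypotheses (mN : measurable N) (nN : null (E := E) N).
Hypothesis Nmu : forall t : measurableTypeR R, ~ N t -> t%:C != mu.

Let mpsi : measurable_fun setT psi.
Proof.
apply: (measurableT_comp (f := (@powR R)^~ alpha)).
  exact: measurable_powR.
by apply: measurable_cabs; exact: borel_sub.
Qed.

Let mphi : measurable_fun setT phi.
Proof.
apply: (measurableT_comp (f := (@powR R)^~ (- alpha))).
  exact: measurable_powR.
by apply: measurable_cabs; exact: borel_sub.
Qed.

Let psi_ge0 t : 0 <= psi t. Proof. exact: powR_ge0. Qed.

Let phi_psi t : ~ N t -> phi t * psi t = 1.
Proof.
move=> Nt; rewrite /phi /psi powRN mulVf // gt_eqF // powR_gt0 // cabs_gt0 //.
by rewrite subr_eq0 Nmu.
Qed.

(** Since [phi psi = 1] off the null set, [f = phi(A0) h], so [(h, Gamma1 f)] belongs to the graph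
    of the operator assumed bounded. *)
Lemma Gamma1_le f h : dom T f -> applies E (fun t => (psi t)%:C) f h ->
  nrm (Gamma1 f) <= c * nrm h.
Proof.
move=> df fh; apply: (hc (p := (h, Gamma1 f))).
exists f; split; last by split => //=; rewrite (qbt_dom1 hPi).
apply/PP => /=; apply: (applies_comp pE (borel_real mpsi) (borel_real mphi) fh).
have one : applies E (fun=> 1) f f.
  by have := @applies_cst _ _ _ pE 1 f; rewrite scale1r.
by apply: (applies_ae pE mN nN _ one) => t Nt; rewrite -rmorphM /= phi_psi.
Qed.

Context {lam : R[i]} {d s : R}.
Hypotheses (d0 : 0 < d) (s0 : 0 <= s).
Hypothesis lamN : forall t : measurableTypeR R, ~ N t -> d <= cabs (t%:C - lam).
Hypothesis psi_s : forall t : measurableTypeR R, ~ N t ->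
  (cabs (t%:C - mu) `^ alpha) ^+ 2 <= s * cabs (t%:C - lam).

Let D (n : nat) : set (measurableTypeR R) := [set t | psi t <= n%:R].

Let mD n : measurable (D n).
Proof.
rewrite (_ : D n = setT `&` psi @^-1` `]-oo, n%:R]%classic).
  by apply: mpsi => //; exact: measurable_itv.
by apply/seteqP; split=> t /=; rewrite in_itv /=; [move=> ?; split|case].
Qed.

(* The truncation of [psi] of [f] to a set where [psi <= n] has norm controlled by
   [Gamma0 f]: its square is [(f, (A0 - lam^* ) k)] for some [k] in the domain
   of [A0], and Green's identity turns this into [(Gamma0 f, Gamma1 k)]. *)
Lemma truncation_le f n : dom T f -> T f = lam *: f ->
  exists2 h, applies E (fun t => (\1_(D n `\` N) t * psi t)%:C) f h &
    nrm h <= c * s * nrm (Gamma0 f).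
Proof.
move=> df Tf; set C := D n `\` N.
have mC : measurable C by exact: measurableD.
have C01 t : \1_C t = 0 :> R \/ \1_C t = 1 :> R /\ C t.
  rewrite indicE; case: (boolP (t \in C)) => [/set_mem|]; by [right|left].
have CN t : C t -> ~ N t by case.
pose lc := lam^*.
have dist_lc (t : measurableTypeR R) : cabs (t%:C - lc) = cabs (t%:C - lam).
  by rewrite -cabs_conj rmorphB /= conjR conjCK.
pose chi t : R := \1_C t.
have mchi : measurable_fun setT chi by exact: measurable_indic.
(* Four bounded functions applied to [f], with [chi] the cut-off: [h = chi psi f],
   [w = chi psi^2 f], [k = (A0 - conj lam)^-1 w] and [j = psi k]. *)
pose hf (t : measurableTypeR R) := (chi t * psi t)%:C.
pose wf t := (chi t * psi t ^+ 2)%:C.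
pose kf (t : measurableTypeR R) := wf t * (t%:C - lc)^-1.
pose jf (t : measurableTypeR R) := (psi t)%:C * kf t.
have mhf : borel hf by apply: borel_real; exact: measurable_funM.
have mwf : borel wf.
  by apply: borel_real; apply: measurable_funM => //; exact: measurable_funX.
have mkf : borel kf by apply: borelM => //; apply: borelV; exact: borel_sub.
have mjf : borel jf by apply: borelM => //; exact: borel_real.
have lc0 t : C t -> t%:C - lc != 0.
  move=> /CN/lamN; rewrite -dist_lc => dt; apply/eqP => t0; move: dt.
  by rewrite t0 cabs0 leNgt d0.
have hb t : cabs (hf t) <= n%:R.
  rewrite /hf cabsR /chi; case: (C01 t) => [->|[-> [Dt _]]].
    by rewrite mul0r normr0.
  by rewrite mul1r ger0_norm ?psi_ge0.
have wb t : cabs (wf t) <= n%:R ^+ 2.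
  rewrite /wf cabsR /chi; case: (C01 t) => [->|[-> [Dt _]]].
    by rewrite mul0r normr0 sqr_ge0.
  by rewrite mul1r ger0_norm ?sqr_ge0 // ler_pXn2r // nnegrE.
have kb t : cabs (kf t) <= s.
  rewrite /kf cabsM cabsV dist_lc /wf cabsR /chi; case: (C01 t) => [->|[-> Ct]].
    by rewrite !mul0r normr0 mul0r.
  have ct : 0 < cabs (t%:C - lam) by apply: lt_le_trans d0 (lamN (CN _ Ct)).
  rewrite mul1r ger0_norm ?sqr_ge0 // ler_pdivrMr // psi_s //; exact: CN.
have jb t : cabs (jf t) <= n%:R * s.
  rewrite /jf cabsM cabsR ger0_norm ?psi_ge0 //.
  have [Ct|Ct] := pselect (C t).
    by rewrite ler_pM ?cabs_ge0 ?kb //; case: Ct.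
  by rewrite /kf /wf /chi indicE memNset // !mul0r cabs0 mulr0 mulr_ge0.
have [h fh] := applies_bounded_exists pE f mhf hb.
have [w fw] := applies_bounded_exists pE f mwf wb.
have [k fk] := applies_bounded_exists pE f mkf kb.
have [j fj] := applies_bounded_exists pE f mjf jb.
exists h => //.
have kw : applies E (fun t => t%:C - lc) k w.
  apply: (applies_comp pE mkf (borel_sub lc) fk).
  rewrite (_ : (fun _ => _) = wf) //; apply/funext => t; rewrite /kf.
  have [Ct|Ct] := pselect (C t); first by rewrite mulrCA divff ?mulr1 // lc0.
  by rewrite /wf /chi indicE memNset // !mul0r mulr0.
have A0k : A0 (k, w + lc *: k).
  apply/A0P => /=; have := applies_shift lc kw; congr (applies E _ _ _).
  by apply/funext => t; rewrite subrK.
have kj : applies E (fun t => (psi t)%:C) k j.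
  exact: (applies_comp pE mkf (borel_real mpsi) fk fj).
(* As [chi^2 = chi], the product [psi kf] equals [kf hf]. Thus [j] is also [kf(A0) h], and the bound
   [s] on [kf] acts on [h], about which more is known than about [f]. *)
have hj : applies E kf h j.
  apply: (applies_comp pE mhf mkf fh).
  rewrite (_ : (fun _ => _) = jf) //; apply/funext => t; rewrite /jf /kf /hf /wf /chi.
  by case: (C01 t) => [->|[-> _]]; rewrite ?mul0r ?mulr0 // !mul1r mulrC.
have hw : applies E hf h w.
  apply: (applies_comp pE mhf mhf fh).
  rewrite (_ : (fun _ => _) = wf) //; apply/funext => t; rewrite /hf /wf /chi.
  rewrite -rmorphM /=; case: (C01 t) => [->|[-> _]]; first by rewrite !mul0r.
  by rewrite !mul1r expr2.
have hh_fw : ip h h = ip f w.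
  by apply: (applies_ip_sym pE (phi := fun t => chi t * psi t)) => //; exact: measurable_funM.
have [[dk /= kE] [_ /= k0]] := A0k.
(* Here [Gamma0 k = 0] because [k] is in the domain of [A0], and the terms in [(f, k)] cancel
   because [lc] is the conjugate of [lam]. *)
have green : ip f w = ip (Gamma0 f) (Gamma1 k).
  have := qbt_green hPi df dk; rewrite Tf -kE -k0 ip0r sub0r.
  rewrite ipZl ipDr ipZr conjCK opprD addrA addrAC subrr add0r.
  by move/oppr_inj.
have hle : nrm h ^+ 2 <= nrm (Gamma0 f) * (c * (s * nrm h)).
  rewrite nrm_sqr hh_fw green (le_trans (ler_norm _)) // (le_trans (normr_Re_le _)) //.
  rewrite (le_trans (CauchySchwarz_ip _ _)) // ler_wpM2l ?nrm_ge0 //.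
  rewrite (le_trans (Gamma1_le dk kj)) // ler_wpM2l //.
  by apply: (applies_le pE hj) => t; exact: kb.
have [->|h0] := eqVneq (nrm h) 0.
  by rewrite !mulr_ge0 ?nrm_ge0.
have {h0} h0 : 0 < nrm h by rewrite lt_def h0 nrm_ge0.
rewrite -(ler_pM2r h0) -expr2 (le_trans hle) // le_eqVlt; apply/orP; left.
by apply/eqP; ring.
Qed.

Lemma weyl_le p : weyl T Gamma0 Gamma1 lam p -> nrm p.2 <= c ^+ 2 * s * nrm p.1.
Proof.
move=> [f [[[_ /= f0] [df /= Tf]] [_ /= f1]]].
rewrite f0 f1; set K := c * s * nrm (Gamma0 f).
have K0 : 0 <= K by rewrite !mulr_ge0 ?nrm_ge0.
pose psiN t := \1_(~` N) t * psi t.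
have mpsiN : measurable_fun setT psiN.
  apply: measurable_funM => //; apply: measurable_indic; exact: measurableC.
have bpsiN := borel_real mpsiN.
have trunc n : (sqint pE (fun t => (psiN t)%:C) f (D n) <= (K ^+ 2)%:E)%E.
  have [h fh hK] := truncation_le n df (esym Tf).
  have mC : measurable (D n `\` N) by exact: measurableD.
  have mh : borel (fun t => (\1_(D n `\` N) t * psi t)%:C).
    by apply: borel_real; apply: measurable_funM => //; exact: measurable_indic.
  apply: (@le_trans _ _ (nrm h ^+ 2)%:E); last first.
    by rewrite lee_fin ler_pXn2r // nnegrE nrm_ge0.
  rewrite -(sqint_applies pE mh fh) /sqint.
  rewrite (_ : (\int[_]_(t in D n) _)%E = (\int[specm pE f]_(t in D n)
     (cabs (\1_(D n `\` N) t * psi t)%:C ^+ 2)%:E)%E); last first.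
    apply: eq_integral => t /set_mem Dt; rewrite /psiN !indicE in_setC in_setD.
    by rewrite (mem_set Dt).
  apply: ge0_subset_integral => //.
  - exact: measurable_cabs_sqr.
  - by move=> t _; rewrite lee_fin sqr_ge0.
have UD : \bigcup_n D n = setT.
  apply/seteqP; split=> t // _; exists (Num.truncn (psi t)).+1 => //.
  by rewrite /D /= ltW // truncnS_gt.
(* Monotone convergence along the exhausting sets [D n], with a bound [K] that does not depend on
   [n], puts [f] into the domain of [psi(A0)]. *)
have intK : (sqint pE (fun t => (psiN t)%:C) f setT <= (K ^+ 2)%:E)%E.
  have : (sqint pE (fun t => (psiN t)%:C) f (D n) @[n --> \oo] -->
     sqint pE (fun t => (psiN t)%:C) f (\bigcup_n D n))%E.
    apply: ge0_nondecreasing_set_cvg_integral => //.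
    - move=> n m nm; apply/subsetPset => t; rewrite /D /= => /le_trans; apply.
      by rewrite ler_nat.
    - by move=> n; exact: measurable_cabs_sqr.
    - by move=> n t _; rewrite lee_fin sqr_ge0.
  rewrite UD => cv; rewrite -(cvg_lim (@ereal_hausdorff _) cv).
  apply: lime_le; first by apply/cvg_ex; eexists; exact: cv.
  exact: nearW.
have [h fh] : exists h, applies E (fun t => (psiN t)%:C) f h.
  by apply: (@applies_exists _ _ _ pE _ f bpsiN); rewrite (le_lt_trans intK) // ltry.
have hK : nrm h <= K.
  move: intK; rewrite (sqint_applies pE bpsiN fh) lee_fin ler_pXn2r //.
  by rewrite nnegrE nrm_ge0.
have fh' : applies E (fun t => (psi t)%:C) f h.
  apply: (applies_ae pE mN nN _ fh) => t Nt.
  by rewrite /psiN indicE mem_set // mul1r.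
apply: le_trans (Gamma1_le df fh') _.
rewrite (le_trans (ler_wpM2l c0 hK)) // le_eqVlt; apply/orP; left.
by apply/eqP; rewrite /K; ring.
Qed.

End weyl_function.

(** * Sectors *)

Lemma op_norm_closure_le (R : realType) (H K : hilbertType R) (A : set (H * K)) (c : R) :
  0 <= c -> (forall p, A p -> nrm p.2 <= c * nrm p.1) ->
  (op_norm (closure A) <= c%:E)%E.
Proof.
move=> c0 hc; apply: ge_ereal_sup => _ [p [clp p1] <-]; rewrite lee_fin.
apply: le_trans (_ : c * nrm p.1 <= _); last by rewrite ler_piMr.
apply/ler_addgt0Pr => e e0.
(* The error [d] in [p.2] and the error [c d] caused by [p.1] add up to [e]. *)
pose d := e / (c + 1); have c1 : 0 < c + 1 by rewrite ltr_wpDl.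
have d0 : 0 < d by rewrite divr_gt0.
have d0C : (0 : R[i]) < d%:C by rewrite ltcR.
have [|q [Aq [q1 q2]]] := clp (ball p.1 d%:C `*` ball p.2 d%:C).
  by exists (ball p.1 d%:C, ball p.2 d%:C) => //; split; exact: nbhsx_ballx.
move: q1 q2; rewrite -!ball_normE /ball_ /= !nrmE !ltcR => q1 q2.
have h1 := nrm_le_sub p.2 q.2.
have h2 := nrm_le_sub q.1 p.1; rewrite nrmBC in h2.
have h3 := hc q Aq.
have h4 : c * nrm q.1 <= c * (d + nrm p.1).
  by rewrite ler_wpM2l // (le_trans h2) // lerD2r ltW.
have de : d * (c + 1) = e by rewrite /d divfK // gt_eqF.
rewrite -de; lra.
Qed.

Section sector_geometry.
Context {R : realType}.
Implicit Types (z w lam : R[i]) (t x : R).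

Lemma cabs_sub_compare z w (d : R) t : 0 < d -> d <= cabs (t%:C - z) ->
  cabs (t%:C - w) <= (1 + cabs (z - w) / d) * cabs (t%:C - z).
Proof.
move=> d0 dt; have -> : t%:C - w = (t%:C - z) + (z - w) by rewrite subrKA.
rewrite (le_trans (cabsD _ _)) // mulrDl mul1r lerD2l mulrAC -mulrA.
by rewrite ler_peMr ?cabs_ge0 // ler_pdivlMr // mul1r.
Qed.

Lemma sin_ge_cos (theta x : R) : 0 < theta < pi / 2 ->
  pi / 2 - theta <= x <= pi / 2 + theta -> cos theta <= sin x.
Proof.
move=> /andP[t0 t1] /andP[x0 x1]; rewrite -cosBpihalf; have pi0 := pi_gt0 R.
have -> : cos (x - pi / 2) = cos `|x - pi / 2| by case: ger0P; rewrite ?cosN.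
have hx : `|x - pi / 2| <= theta by rewrite ler_norml; lra.
rewrite leNgt ltr_cos ?in_itv /= ?normr_ge0 /=; first by rewrite -leNgt.
  by lra.
by rewrite (le_trans hx) //; lra.
Qed.

Lemma cos_le_cos (nu x : R) : 0 < nu < pi -> nu <= x <= 2 * pi - nu ->
  cos x <= cos nu.
Proof.
move=> /andP[n0 n1] /andP[x0 x1]; have pi0 := pi_gt0 R.
have main y : nu <= y <= pi -> cos y <= cos nu.
  move=> /andP[y0 y1]; rewrite leNgt ltr_cos ?in_itv /= -?leNgt //; lra.
have [xpi|xpi] := leP x pi; first by apply: main; rewrite x0.
have -> : cos x = cos (2 * pi - x).
  by rewrite -[LHS]cosN -(cosD2pi (- x)) addrC mulr_natl.
by apply: main; lra.
Qed.

Lemma sectorS_Im z0 theta lam : 0 < theta < pi / 2 -> sectorS z0 theta lam ->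
  cos theta * cabs (lam - z0) <= complex.Im (lam - z0).
Proof.
move=> th [[lz [x [[_ xE] xth]]]|->]; last by rewrite subrr cabs0 mulr0.
rewrite {2}xE ImM /= mul0r addr0 mulrC ler_wpM2l ?cabs_ge0 //.
exact: sin_ge_cos.
Qed.

(** In the sector [cos theta |lam - z0|] is at most the imaginary part of [lam - z0]. As [z0] is in
    the closed upper half-plane, this is at most that of [lam], hence at most the distance from
    [lam] to the real point [t]. *)
Lemma sectorS_compare z0 theta lam t : 0 < theta < pi / 2 -> 0 <= complex.Im z0 ->
  sectorS z0 theta lam ->
  cabs (t%:C - z0) <= (1 + (cos theta)^-1) * cabs (t%:C - lam).
Proof.
move=> th z0p /(sectorS_Im th) h.
have c0 : 0 < cos theta by apply: cos_gt0_pihalf; case/andP: th => *; lra.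
have -> : t%:C - z0 = (t%:C - lam) + (lam - z0) by rewrite subrKA.
rewrite (le_trans (cabsD _ _)) // mulrDl mul1r lerD2l mulrC ler_pdivlMr // mulrC.
apply: le_trans h _; rewrite cabsBC (le_trans _ (normr_Im_le _)) //.
rewrite (le_trans _ (ler_norm _)) // !ImD !ImN /=; lra.
Qed.

(** Law of cosines, with [p = t - w0] and [r = |lam - w0|]: since [cos x <= cos nu], the squared
    distance is at least [p^2 - 2 p r cos nu + r^2 = (p cos nu - r)^2 + (p sin nu)^2]. *)
Lemma sectorU_compare (w0 nu : R) lam t : 0 < nu < pi -> w0 <= t ->
  sectorU w0 nu lam -> sin nu * cabs (t%:C - w0%:C) <= cabs (t%:C - lam).
Proof.
move=> hnu wt; have s0 : 0 < sin nu by exact: sin_gt0_pi.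
have s1 := sin_le1 nu.
move=> [[lw [x [[_ xE] xnu]]]|->]; last first.
  by rewrite ler_piMl ?cabs_ge0.
have hcos := cos_le_cos hnu xnu.
set r := cabs (lam - w0%:C) in xE.
have r0 : 0 <= r := cabs_ge0 _.
rewrite -rmorphB /= cabsR ger0_norm ?subr_ge0 //.
rewrite -(@ler_pXn2r _ 2) ?nnegrE ?cabs_ge0 ?mulr_ge0 ?subr_ge0 ?(ltW s0) //.
have -> : t%:C - lam = (t - w0)%:C - r%:C * (cos x +i* sin x).
  by rewrite -xE rmorphB /= opprB addrA subrK.
rewrite cabs_sqr !(ReD, ImD, ReN, ImN, ReM, ImM) /=.
set p := t - w0; have p0 : 0 <= p by rewrite subr_ge0.
have cs := cos2Dsin2 x; have cn := cos2Dsin2 nu.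
have : 0 <= (p * cos nu - r) ^+ 2 by exact: sqr_ge0.
have : 0 <= p * r * (cos nu - cos x).
  by rewrite !mulr_ge0 // subr_ge0.
have -> : (p - (r * cos x - 0 * sin x)) ^+ 2 + (0 - (r * sin x + 0 * cos x)) ^+ 2
  = p ^+ 2 - 2 * p * r * cos x + r ^+ 2 * (cos x ^+ 2 + sin x ^+ 2) by ring.
rewrite cs; have -> : (sin nu * p) ^+ 2 = p ^+ 2 - p ^+ 2 * cos nu ^+ 2.
  by rewrite exprMn (_ : sin nu ^+ 2 = 1 - cos nu ^+ 2); [ring|lra].
nra.
Qed.

(** The origin of the exponent: [x^(2 alpha) = x / x^(1 - 2 alpha) <= x / d^(1 - 2 alpha)], where
    [alpha <= 1/2] makes the last power nondecreasing. *)
Lemma powR_rate (x y d k alpha : R) : 0 < d -> d <= x -> 0 <= k -> 0 <= y ->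
  y <= k * x -> 0 < alpha <= 1 / 2 ->
  (y `^ alpha) ^+ 2 <= k `^ (2 * alpha) / d `^ (1 - 2 * alpha) * x.
Proof.
move=> d0 dx k0 y0 yx /andP[a0 a1].
have x0 : 0 < x by exact: lt_le_trans dx.
have -> : (y `^ alpha) ^+ 2 = y `^ (2 * alpha).
  by rewrite -powR_mulrn ?powR_ge0 // -powRrM mulrC.
have h : y `^ (2 * alpha) <= k `^ (2 * alpha) * x `^ (2 * alpha).
  rewrite -powRM ?(ltW x0) //; apply: ge0_ler_powR => //; rewrite ?nnegrE //; first lra.
  by rewrite mulr_ge0 // ltW.
apply: le_trans h _; rewrite -mulrA ler_wpM2l ?powR_ge0 //.
have dp : 0 < d `^ (1 - 2 * alpha) by exact: powR_gt0.
rewrite [leRHS]mulrC ler_pdivlMr //.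
have {2}-> : x = x `^ (2 * alpha) * x `^ (1 - 2 * alpha).
  rewrite -powRD; last by rewrite (gt_eqF x0) implybT.
  by rewrite addrC subrK powRr1 // ltW.
rewrite ler_wpM2l ?powR_ge0 //; apply: ge0_ler_powR => //;
  rewrite ?nnegrE ?(ltW x0) ?(ltW d0) //; lra.
Qed.

End sector_geometry.

(** * Distance to the spectrum and spectra of semibounded operators *)

Section distance_to_spectrum.
Context {R : realType} {H : hilbertType R} {E : set (measurableTypeR R) -> H -> H}.
Hypothesis pE : projection_valued_measure E.
Context {A0 : set (H * H)}.
Hypothesis A0P : forall p, A0 p <-> applies E (fun t => t%:C) p.1 p.2.
Implicit Types (lam w : R[i]).

Lemma resolvent_conj lam : resolvent_set A0 lam -> resolvent_set A0 lam^*.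
Proof.
move=> /(resolvent_null_disc pE A0P)[d d0 nd].
apply: (null_disc_resolvent pE A0P d0).
rewrite (_ : disc lam^* d = disc lam d) //; apply/seteqP; split=> t;
  by rewrite /disc /= -(cabs_conj (_ - lam)) rmorphB /= conjR.
Qed.

Lemma resolvent_open lam : resolvent_set A0 lam ->
  exists2 d, 0 < d & forall w, spectrum A0 w -> d <= cabs (lam - w).
Proof.
move=> /(resolvent_null_disc pE A0P)[d d0 nd].
have d2 : 0 < d / 2 by rewrite divr_gt0.
exists (d / 2) => // w sw; rewrite leNgt; apply/negP => wd; apply: sw.
apply: (null_disc_resolvent pE A0P d2); apply: (null_disc_nbhs pE nd).
by rewrite cabsBC ltW.
Qed.

Lemma dist_gt0 lam : resolvent_set A0 lam -> spectrum A0 !=set0 ->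
  0 < dist lam (spectrum A0).
Proof.
move=> /resolvent_open[d d0 hd] [w0 s0]; apply: lt_le_trans d0 _.
by apply: lb_le_inf => [|_ [w sw <-]]; [exists (cabs (lam - w0)); exists w0|exact: hd].
Qed.

Lemma dist_le lam w : spectrum A0 w -> dist lam (spectrum A0) <= cabs (lam - w).
Proof.
by move=> sw; apply: ge_inf; [exists 0 => _ [v _ <-]; exact: cabs_ge0|exists w].
Qed.

(** For [t < c] the Cauchy-Schwarz inequality gives [(c - t) |f| <= |(A0 - t) f|], which is the
    lower bound that makes a disc about [t] null. *)
Lemma bounded_below_spectrum (c : R) :
  (forall p, A0 p -> c * nrm p.1 ^+ 2 <= complex.Re (ip p.2 p.1)) ->
  forall t : R, spectrum A0 t%:C -> c <= t.
Proof.
move=> hc t st; rewrite leNgt; apply/negP => tc; apply: st.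
have ct : 0 < c - t by rewrite subr_gt0.
suff : exists2 d, 0 < d & null (E := E) (disc t%:C d).
  by move=> [d d0]; exact: (null_disc_resolvent pE A0P d0).
apply: (bounded_below_null_disc pE A0P (c := (c - t)^-1)) => p Ap.
have [->|p0] := eqVneq (nrm p.1) 0; first by rewrite mulr_ge0 ?invr_ge0 ?nrm_ge0 // ltW.
have {p0} p0 : 0 < nrm p.1 by rewrite lt_def p0 nrm_ge0.
rewrite mulrC ler_pdivlMr // -(ler_pM2r p0) -mulrA mulrCA -expr2.
apply: le_trans (le_trans (ler_norm _) (le_trans (normr_Re_le _)
  (CauchySchwarz_ip (p.2 - t%:C *: p.1) p.1))).
rewrite ipBl ipZl ip_sqr -rmorphM /= ReD ReN /= mulrBl lerD2r.
exact: hc.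
Qed.

End distance_to_spectrum.

(** * Comparison constants and the three norm bounds *)

Theorem theorem6p1 (R : realType) (H G : hilbertType R)
  (S T : linop H H) (Gamma0 Gamma1 : linop H G)
  (hS : closed_symmetric S)
  (hPi : quasi_boundary_triple S T Gamma0 Gamma1)
  (A0 : set (H * H)) (hA0 : A0 = A0_of T Gamma0)
  (M : R[i] -> set (G * G)) (hM : M = weyl T Gamma0 Gamma1)
  (mu : R[i]) (hmu : resolvent_set A0 mu)
  (alpha : R) (halpha : 0 < alpha <= 1 / 2)
  (P : set (H * H))
  (hP : functional_calculus A0 (fun t : R => cabs (t%:C - mu) `^ (- alpha)) P)
  (hbounded : bounded_rel (rel_comp (graph Gamma1) P)) :
  [/\ forall lambda, resolvent_set A0 lambda -> bounded_rel (M lambda),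
      forall (z0 : R[i]) (theta : R),
        0 <= complex.Im z0 -> resolvent_set A0 z0 -> 0 < theta < pi / 2 ->
        exists2 C : R, 0 < C &
          forall lambda, (sectorS z0 theta `|` sectorS_conj z0 theta) lambda ->
          (op_norm (closure (M lambda)) <=
           (C / dist lambda (spectrum A0) `^ (1 - 2 * alpha))%:E)%E
    & bounded_below A0 ->
      forall (w0 nu : R), w0 < min_spectrum A0 -> 0 < nu < pi ->
        exists2 D : R, 0 < D &
          forall lambda, sectorU w0 nu lambda ->
          (op_norm (closure (M lambda)) <=
           (D / dist lambda (spectrum A0) `^ (1 - 2 * alpha))%:E)%E ].
Proof.
have [E [[pE A0E] PE]] := hP.
have A0P p : A0 p <-> applies E (fun t => t%:C) p.1 p.2.
  by rewrite A0E; apply: (spectral_integralP pE); exact: measurable_id.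
pose phi (t : measurableTypeR R) : R := cabs (t%:C - mu) `^ (- alpha).
have mphi : measurable_fun setT phi.
  apply: (measurableT_comp (f := (@powR R)^~ (- alpha))).
    exact: measurable_powR.
  by apply: measurable_cabs; exact: borel_sub.
have PP p : P p <-> applies E (fun t => (phi t)%:C) p.1 p.2.
  by rewrite PE; exact: (spectral_integralP pE).
have [c0 hc0] := hbounded; pose c : R := `|c0|.
have c_ge0 : 0 <= c := normr_ge0 _.
have hc p : rel_comp (graph Gamma1) P p -> nrm p.2 <= c * nrm p.1.
  by move=> /hc0 /le_trans; apply; rewrite ler_wpM2r ?nrm_ge0 // ler_norm.
have [N [mN nN NP]] := null_real_resolvent pE A0P.
have Nspec (t : R) : ~ N t -> spectrum A0 t%:C by move=> Nt /NP.
have Nmu (t : measurableTypeR R) : ~ N t -> t%:C != mu.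
  by move=> /Nspec st; apply/eqP => tmu; apply: st; rewrite tmu.
pose rate k lam := c ^+ 2 * k `^ (2 * alpha) / dist lam (spectrum A0) `^ (1 - 2 * alpha).
have rate_ge0 k lam : 0 <= rate k lam.
  by rewrite /rate !mulr_ge0 ?invr_ge0 ?powR_ge0 // sqr_ge0.
have bound lam k : resolvent_set A0 lam -> 0 <= k ->
    (forall t : R, spectrum A0 t%:C -> cabs (t%:C - mu) <= k * cabs (t%:C - lam)) ->
    forall p, M lam p -> nrm p.2 <= rate k lam * nrm p.1.
  move=> rl k0 hk p; rewrite hM => Mp.
  have [s0|/set0P/negP/negPn/eqP s0] := pselect (spectrum A0 !=set0).
    have d0 := dist_gt0 pE A0P rl s0; set d := dist lam (spectrum A0) in d0.
    have dN (t : measurableTypeR R) : ~ N t -> d <= cabs (t%:C - lam).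
      by move=> /Nspec st; rewrite cabsBC; exact: dist_le.
    have A0P' p' : A0_of T Gamma0 p' <-> applies E (fun t => t%:C) p'.1 p'.2.
      by rewrite -hA0.
    have -> : rate k lam = c ^+ 2 * (k `^ (2 * alpha) / d `^ (1 - 2 * alpha)).
      by rewrite /rate mulrA.
    apply: (weyl_le hPi pE A0P' PP c_ge0 hc mN nN Nmu d0 _ dN _ Mp).
      by rewrite mulr_ge0 ?invr_ge0 ?powR_ge0.
    move=> t Nt; apply: powR_rate => //; first exact: dN.
      exact: cabs_ge0.
    exact/hk/Nspec.
  (* [dist] is a junk value when the spectrum is empty, but then [H] is trivial. *)
  have H0 (f : H) : f = 0.
    rewrite -(pvm_setT pE f); apply: (pvm_null_sub pE _ mN _ (nN f)) => // t _.
    have ns : ~ spectrum A0 t%:C by rewrite s0.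
    by apply: NP; apply: contrapT.
  have lin0 (A : linop H G) : A 0 = 0.
    have := Defs.appP 1 (dom0 A) (dom0 A); rewrite !scale1r addr0 => /eqP.
    by rewrite -subr_eq subrr => /eqP.
  move: Mp => [f [_ [_ /= ->]]]; rewrite (H0 f) lin0 nrm0.
  by rewrite mulr_ge0 ?nrm_ge0.
split.
(* For a single point [k] may depend on [lam], through the gap [d] between [lam] and the
   spectrum. *)
- move=> lam rl; have [d d0 hd] := resolvent_open pE A0P rl.
  exists (rate (1 + cabs (lam - mu) / d) lam).
  apply: bound => //; first by rewrite addr_ge0 // divr_ge0 ?cabs_ge0 ?ltW.
  by move=> t /hd; rewrite cabsBC; exact: cabs_sub_compare.
- move=> z0 theta Iz0 rz0 hth; have [d d0 hd] := resolvent_open pE A0P rz0.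
  have ct : 0 < cos theta by apply: cos_gt0_pihalf; case/andP: hth => *; lra.
  (* The first factor compares [mu] with the fixed point [z0] through the gap [d] at [z0]; the
     second compares [z0] with [lam] and depends on the opening angle only. *)
  pose k := (1 + cabs (z0 - mu) / d) * (1 + (cos theta)^-1).
  have k1 : 0 <= 1 + cabs (z0 - mu) / d by rewrite addr_ge0 // divr_ge0 ?cabs_ge0 ?ltW.
  have k0 : 0 <= k by rewrite mulr_ge0 // addr_ge0 // invr_ge0 ltW.
  (* The summand 1 keeps the constant positive even when [c = 0]. *)
  exists (c ^+ 2 * k `^ (2 * alpha) + 1); first by rewrite ltr_wpDl // mulr_ge0 ?sqr_ge0 ?powR_ge0.
  have rS lam : sectorS z0 theta lam -> resolvent_set A0 lam.
    move=> Sl; have [->//|lz0] := eqVneq lam z0.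
    apply: (resolvent_nonreal pE A0P); apply: lt0r_neq0.
    have := sectorS_Im hth Sl; rewrite ImD ImN lerBrDr; apply: lt_le_trans.
    by rewrite ltr_pwDl // mulr_gt0 // cabs_gt0 // subr_eq0.
  have kS lam : sectorS z0 theta lam -> forall t : R, spectrum A0 t%:C ->
      cabs (t%:C - mu) <= k * cabs (t%:C - lam).
    move=> Sl t st; have := hd _ st; rewrite cabsBC => dt.
    rewrite (le_trans (cabs_sub_compare mu d0 dt)) // /k -mulrA ler_wpM2l //.
    exact: sectorS_compare Sl.
  move=> lam Sl; apply: (@le_trans _ _ (rate k lam)%:E).
    apply: op_norm_closure_le => //; apply: bound => //.
    + case: Sl => [/rS//|/rS/(resolvent_conj pE A0P)]; by rewrite conjCK.
    + case: Sl => [/kS//|/kS hk t /hk].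
      by rewrite -(cabs_conj (_ - lam^*)) rmorphB /= conjR conjCK.
  by rewrite lee_fin ler_wpM2r ?invr_ge0 ?powR_ge0 // lerDl.
- move=> [b hb] w0 nu hw0 hnu.
  have s0 : 0 < sin nu by exact: sin_gt0_pi.
  pose m := min_spectrum A0.
  have mt (t : R) : spectrum A0 t%:C -> m <= t.
    move=> st; apply: ge_inf => //; exists b => x.
    exact: (bounded_below_spectrum pE A0P hb).
  have wt (t : R) : spectrum A0 t%:C -> w0 <= t.
    by move=> /mt; apply: le_trans; exact: ltW.
  have mw : 0 < m - w0 by rewrite subr_gt0.
  (* Now [w0] takes the place of [z0], with the explicit gap [m - w0] below the spectrum. *)
  pose k := (1 + cabs (w0%:C - mu) / (m - w0)) * (sin nu)^-1.
  have k1 : 0 <= 1 + cabs (w0%:C - mu) / (m - w0).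
    by rewrite addr_ge0 // divr_ge0 ?cabs_ge0 ?ltW.
  have k0 : 0 <= k by rewrite mulr_ge0 // invr_ge0 ltW.
  exists (c ^+ 2 * k `^ (2 * alpha) + 1); first by rewrite ltr_wpDl // mulr_ge0 ?sqr_ge0 ?powR_ge0.
  have tw (t : R) : spectrum A0 t%:C -> m - w0 <= cabs (t%:C - w0%:C).
    move=> st; rewrite -rmorphB /= cabsR ger0_norm ?subr_ge0 ?wt //.
    by rewrite lerD2r mt.
  move=> lam Ul.
  have Ut (t : R) : spectrum A0 t%:C ->
      sin nu * cabs (t%:C - w0%:C) <= cabs (t%:C - lam).
    by move=> st; apply: sectorU_compare => //; exact: wt.
  (* Every real spectral point is at distance at least [sin nu (m - w0)] from [lam], so the disc of
     that radius meets the real line only within the null set [N]. *)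
  have rl : resolvent_set A0 lam.
    have e0 : 0 < sin nu * (m - w0) by rewrite mulr_gt0.
    apply: (null_disc_resolvent pE A0P e0).
    apply: (null_sub pE _ mN _ nN); first exact: measurable_disc.
    move=> t tl; apply: contrapT => /Nspec st; move: tl; rewrite /disc /=.
    apply/negP; rewrite -leNgt (le_trans _ (Ut _ st)) // ler_wpM2l ?(ltW s0) //.
    exact: tw.
  apply: (@le_trans _ _ (rate k lam)%:E).
    apply: op_norm_closure_le => //; apply: bound => // t st.
    rewrite (le_trans (cabs_sub_compare mu mw (tw _ st))) // /k -mulrA ler_wpM2l //.
    by rewrite mulrC ler_pdivlMr // mulrC Ut.
  by rewrite lee_fin ler_wpM2r ?invr_ge0 ?powR_ge0 // lerDl.
Qed.
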